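(* Let $P$ be a set of skew-indecomposable (non-empty) permutations such that every element of $\overline{P}$ is sum-indecomposable, and let $n\ge0$. Then the staircase encoding $\mathrm{SE}$ is a bijection between $\mathrm{Av}^{(n)}(2413,3124,1\oplus P)$ and $\mathrm{WI}_{\rho}(\mathcal{UD}(B_n),\mathrm{Av}^{+}(312,\overline{P}),\mathrm{Av}^{+}(2413,3124,P))$.
   Context: A permutation of size $n$ is a word containing each of $1,\dots,n$ exactly once. $\sigma$ contains $\pi$ if some subsequence of $\sigma$ has the same relative order as $\pi$; otherwise it avoids $\pi$. $\mathrm{Av}(P)$ is the set of permutations avoiding every element of $P$, $\mathrm{Av}^{+}(P)$ its non-empty elements. For $\alpha$ of size $a$, $\beta$ of size $b$: $\alpha\oplus\beta=\alpha_1\cdots\alpha_a(\beta_1+a)\cdots(\beta_b+a)$ and $\alpha\ominus\beta=(\alpha_1+b)\cdots(\alpha_a+b)\beta_1\cdots\beta_b$; a permutation is sum-indecomposable (resp. skew-indecomposable) if it is not $\alpha\oplus\beta$ (resp. $\alpha\ominus\beta$) with $\alpha,\beta$ non-empty. $1\oplus P=\{1\oplus\pi:\pi\in P\}$. The empty permutation is not in $P$. For a permutation $\sigma$, $\overline{\sigma}=\alpha$ if $\sigma=\alpha\oplus1$, and $\overline{\sigma}=\sigma$ otherwise; $\overline{P}=\{\overline{\pi}:\pi\in P\}$. A left-to-right minimum of $\sigma$ is an entry $\sigma_i$ with $\sigma_j>\sigma_i$ for all $j<i$; $\mathrm{Av}^{(n)}(Q)$ is the set of permutations in $\mathrm{Av}(Q)$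 with exactly $n$ left-to-right minima. $B_n=\{(i,j):1\le i\le j\le n\}$ (row $i$, column $j$, row 1 on top). If $\sigma$ has left-to-right minima at positions $p_1<\dots<p_n$ with values $v_1>\dots>v_n$, each non-minimum entry $\sigma_k$ lies in cell $(i,j)$ where $j$ is the largest index with $p_j<k$ and $i$ the smallest index with $v_i<\sigma_k$. $\mathrm{SE}(\sigma)$ is the filling of $B_n$ putting in each cell the standardization of the entries of $\sigma$ in that cell (empty permutation if none). $\mathcal{UD}(B_n)$ is the graph on $B_n$ in which distinct $(i,j),(k,\ell)$ are adjacent iff $i>k$ and $j<\ell$ (or symmetrically), or $i<k$, $j<\ell$ and $\{i,\dots,k\}\times\{j,\dots,\ell\}\subseteq B_n$ (or symmetrically). For an independent set $I$ and $v\in I$, $\rho(v,I)=y$ if $v$ is not the rightmost cell of $I$ in its row, and $\rho(v,I)=z$ otherwise. $\mathrm{WI}_\rho(G,Y,Z)$ is the set of fillings of $B_n$ whose set $I$ of non-empty cells is an independent set of $G$, where each $v\in I$ contains an element of $Y$ if $\rho(v,I)=y$ and of $Z$ if $\rho(v,I)=z$. ''SE is a bijection between $X$ and $W$'' means SE restricted to $X$ is injective with image exactly $W$. *)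

(* Defs.v *)
From HB Require Import structures.
From mathcomp Require Import all_boot.
From mathcomp Require Import boolp classical_sets functions.

Set Implicit Arguments.
Unset Strict Implicit.
Unset Printing Implicit Defensive.

Local Open Scope classical_set_scope.

(* Permutations are words: values are 1-based, while positions, and the row
   and column indices below, are 0-based. *)
Definition is_perm (s : seq nat) : bool := perm_eq s (iota 1 (size s)).

Definition same_order (t p : seq nat) : Prop :=
  size t = size p /\
  forall i j, i < size t -> j < size t ->
    (nth 0 t i < nth 0 t j) = (nth 0 p i < nth 0 p j).

Definition contains (s p : seq nat) : Prop :=
  exists2 t : seq nat, subseq t s & same_order t p.

Definition Av (Q : set (seq nat)) : set (seq nat) :=
  [set s | is_perm s /\ forall p, Q p -> ~ contains s p].

Definition Avplus (Q : set (seq nat)) : set (seq nat) :=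
  [set s | Av Q s /\ s <> [::]].

Definition osum (a b : seq nat) : seq nat :=
  a ++ [seq x + size a | x <- b].

Definition oskew (a b : seq nat) : seq nat :=
  [seq x + size b | x <- a] ++ b.

Definition sum_indecomposable (s : seq nat) : Prop :=
  forall a b, is_perm a -> is_perm b -> a <> [::] -> b <> [::] ->
    s <> osum a b.

Definition skew_indecomposable (s : seq nat) : Prop :=
  forall a b, is_perm a -> is_perm b -> a <> [::] -> b <> [::] ->
    s <> oskew a b.

(* If s = osum a [:: 1] then a can only be s without its last letter; in
   particular bar [:: 1] is the empty permutation. *)
Definition bar (s : seq nat) : seq nat :=
  let a := take (size s).-1 s in
  if s == osum a [:: 1] then a else s.

Definition std (w : seq nat) : seq nat :=
  [seq count (fun y => y <= x) w | x <- w].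

Definition is_lrmin (s : seq nat) (k : nat) : bool :=
  all (fun x => nth 0 s k < x) (take k s).

Definition lrmin_pos (s : seq nat) : seq nat :=
  [seq k <- iota 0 (size s) | is_lrmin s k].

Definition lrmin_val (s : seq nat) : seq nat :=
  [seq nth 0 s k | k <- lrmin_pos s].

Definition Avn (n : nat) (Q : set (seq nat)) : set (seq nat) :=
  [set s | Av Q s /\ size (lrmin_pos s) = n].

(* The pair (i, j) of B_n is represented by (i - 1, j - 1). *)
Definition cell (n : nat) : finType := {c : 'I_n * 'I_n | c.1 <= c.2}.
Definition row n (c : cell n) : nat := (val c).1.
Definition col n (c : cell n) : nat := (val c).2.

Definition filling (n : nat) : Type := {ffun cell n -> seq nat}.

Definition largest (A : pred nat) (m j : nat) : bool :=
  [&& j < m, A j & all (fun j' => A j' ==> (j' <= j)) (iota 0 m)].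
Definition smallest (A : pred nat) (m i : nat) : bool :=
  [&& i < m, A i & all (fun i' => A i' ==> (i <= i')) (iota 0 m)].

Definition in_cell (s : seq nat) (i j k : nat) : bool :=
  let p := lrmin_pos s in
  let v := lrmin_val s in
  [&& ~~ is_lrmin s k,
      largest (fun j' => nth 0 p j' < k) (size p) j &
      smallest (fun i' => nth 0 v i' < nth 0 s k) (size v) i].

(* Meaningful when s has exactly n left-to-right minima. *)
Definition SE (n : nat) (s : seq nat) : filling n :=
  [ffun c => std [seq nth 0 s k | k <- iota 0 (size s)
                                & in_cell s (row c) (col c) k]].

Definition UD_half n (c d : cell n) : bool :=
  ((row c > row d) && (col c < col d)) ||
  [&& row c < row d, col c < col d &
      [forall r : 'I_n, forall q : 'I_n,
        (row c <= r <= row d) && (col c <= q <= col d) ==> (r <= q)]].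

Definition UD (n : nat) : rel (cell n) :=
  fun c d => UD_half c d || UD_half d c.

Definition independent (T : finType) (G : rel T) (I : {set T}) : Prop :=
  forall u v, u \in I -> v \in I -> u != v -> ~~ G u v.

Inductive weight : Set := weight_y | weight_z.

Definition rho n (v : cell n) (I : {set cell n}) : weight :=
  if [exists u in I, (row u == row v) && (col v < col u)]
  then weight_y else weight_z.

Definition support n (f : filling n) : {set cell n} :=
  [set c | f c != [::]]%SET.

Definition WI n (r : cell n -> {set cell n} -> weight) (G : rel (cell n))
    (Y Z : set (seq nat)) : set (filling n) :=
  [set f | independent G (support f) /\
     forall v, v \in support f ->
       match r v (support f) with
       | weight_y => Y (f v)
       | weight_z => Z (f v)
       end].

(* Main.v *)
Require Import Defs.
From HB Require Import structures.
From mathcomp Require Import all_boot zify.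
From mathcomp Require Import boolp classical_sets functions.

(* Write v_1 > ... > v_n for the left-to-right minima. If a and b lie in the
   cells (i, j) and (i, l) with j < l, then a > b would make v_i a v_l b a 2413;
   if a and b lie in (i, j) and (k, j) with i < k, then b to the left of a would
   make v_i v_k b a a 3124. So cells of a row increase from left to right, cells
   of a column decrease from top to bottom, and the encoding determines the
   permutation; the edges of UD are excluded by the same two patterns. A Y-cell
   has an entry to its upper right and v_i to its lower left, which accounts for
   312 and the barred patterns.

   Conversely, a filling prescribes the relative order of all entries. In an
   occurrence of 1 + p, the entry 1 may be taken to be a minimum; the cells to
   its upper right that meet the occurrence are pairwise collinear, so they form
   a single row or a single column. Skew-indecomposability of p rules out several
   cells in a column, and sum-indecomposability of the barred p forces an
   occurrence across a row to have all but its last entry in one Y-cell. The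
   patterns 2413 and 3124 either reduce to the same argument or use two minima,
   in which case the independence in UD contradicts them at once. *)

Set Implicit Arguments.
Unset Strict Implicit.
Unset Printing Implicit Defensive.

(** * Order isomorphism and ranks *)

Lemma is_perm_uniq s : is_perm s -> uniq s.
Proof. by move=> /perm_uniq ->; rewrite iota_uniq. Qed.

Lemma is_perm_gt0 s x : is_perm s -> x \in s -> 0 < x.
Proof. by move=> /perm_mem ->; rewrite mem_iota => /andP[]. Qed.

Lemma is_perm_le s x : is_perm s -> x \in s -> x <= size s.
Proof. by move=> /perm_mem ->; rewrite mem_iota; lia. Qed.

Lemma is_perm_char s :
  uniq s -> (forall x, x \in s -> 0 < x <= size s) -> is_perm s.
Proof.
move=> us hs; apply: uniq_perm (iota_uniq _ _) _ => //.
have sub : {subset s <= iota 1 (size s)} by move=> x /hs; rewrite mem_iota; lia.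
by have [] := uniq_min_size us sub; rewrite ?size_iota.
Qed.

Lemma count_nth (a : pred nat) s :
  count a s = count (fun i => a (nth 0 s i)) (iota 0 (size s)).
Proof. by rewrite -[in LHS](mkseq_nth 0 s) /mkseq count_map. Qed.

Lemma perm_nth_count s i : is_perm s -> i < size s ->
  nth 0 s i = count (fun x => x <= nth 0 s i) s.
Proof.
move=> ps lti; rewrite (permP ps).
have lex := is_perm_le ps (mem_nth 0 lti); set x := nth 0 s i in lex *.
rewrite -(subnKC lex) iotaD count_cat (_ : count _ (iota 1 x) = x).
  rewrite (_ : count _ (iota (1 + x) _) = 0) ?addn0 //; apply/eqP.
  rewrite -leqn0 leqNgt -has_count.
  by apply/hasPn => y; rewrite mem_iota; lia.
rewrite -[RHS](size_iota 1 x); apply/eqP; rewrite -all_count.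
by apply/allP => y; rewrite mem_iota; lia.
Qed.

(** In a permutation each value is the number of entries not exceeding it, and that number depends
    on the relative order alone. *)
Lemma perm_same_order_eq s t :
  is_perm s -> is_perm t -> same_order s t -> s = t.
Proof.
move=> ps pt [szE st]; apply: (@eq_from_nth _ 0) => // i lti.
rewrite (perm_nth_count ps lti) (perm_nth_count pt) -?szE //.
rewrite (count_nth _ s) (count_nth _ t) -szE.
apply: eq_in_count => j; rewrite mem_iota => ltj.
by rewrite [LHS]leqNgt [RHS]leqNgt st.
Qed.

Lemma same_order_trans s t u :
  same_order s t -> same_order t u -> same_order s u.
Proof.
by case=> e h [e' h']; split=> [|i j hi hj]; rewrite ?e ?h ?h' // -e.
Qed.

(** Counting the elements not strictly above [x] includes [x] itself, so ranks start at 1; for [ltn]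
    on a word this is standardization. *)
Definition rank (T : eqType) (lt : rel T) (L : seq T) (x : T) :=
  count (fun y => ~~ lt x y) L.

Lemma rank_mono (T : eqType) (lt : rel T) (L : seq T) x y :
  irreflexive lt -> transitive lt -> y \in L -> lt x y ->
  rank lt L x < rank lt L y.
Proof.
move=> irr tr yL xy; rewrite /rank.
have -> : count (fun z => ~~ lt y z) L =
   count (fun z => ~~ lt x z) L + count (fun z => ~~ lt y z && lt x z) L.
  elim: L {yL} => //= z L ->; have := tr y x z xy.
  by case: (lt y z); case: (lt x z) => //=; lia.
rewrite -addn1 leq_add2l -has_count; apply/hasP; exists y => //.
by rewrite irr xy.
Qed.

Lemma rank_ltE (T : eqType) (lt : rel T) (L : seq T) :
  irreflexive lt -> transitive lt ->
  {in L &, forall x y, [|| x == y, lt x y | lt y x]} ->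
  {in L &, forall x y, (rank lt L x < rank lt L y) = lt x y}.
Proof.
move=> irr tr tot x y xL yL; have /or3P[/eqP->|xy|yx] := tot x y xL yL.
- by rewrite irr ltnn.
- by rewrite xy rank_mono.
- rewrite [RHS](_ : _ = false); last first.
    by apply/negP => xy; have := tr _ _ _ xy yx; rewrite irr.
  by apply/negbTE; rewrite -leqNgt ltnW // rank_mono.
Qed.

Lemma rank_perm (T : eqType) (lt : rel T) (L : seq T) :
  irreflexive lt -> transitive lt -> uniq L ->
  {in L &, forall x y, [|| x == y, lt x y | lt y x]} ->
  is_perm [seq rank lt L x | x <- L].
Proof.
move=> irr tr uL tot; apply: is_perm_char.
  rewrite map_inj_in_uniq // => x y xL yL e; have := tot x y xL yL.
  rewrite -(rank_ltE irr tr tot) // -(rank_ltE irr tr tot) // e ltnn !orbF.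
  by move/eqP.
move=> _ /mapP[x xL ->]; rewrite size_map count_size andbT -has_count.
by apply/hasP; exists x => //; rewrite irr.
Qed.

Lemma std_rank w : std w = [seq rank ltn w x | x <- w].
Proof. by apply: eq_map => x; apply: eq_count => y /=; rewrite leqNgt. Qed.

Lemma size_std w : size (std w) = size w.
Proof. exact: size_map. Qed.

Lemma std_perm w : uniq w -> is_perm (std w).
Proof.
move=> uw; rewrite std_rank; apply: rank_perm => //.
- exact: ltnn.
- exact: ltn_trans.
- by move=> x y _ _ /=; lia.
Qed.

Lemma std_same_order w : same_order (std w) w.
Proof.
rewrite std_rank; split; rewrite size_map // => i j lti ltj.
rewrite !(nth_map 0) //; apply: rank_ltE; rewrite ?mem_nth //.
- exact: ltnn.
- exact: ltn_trans.
- by move=> x y _ _ /=; lia.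
Qed.

Lemma std_unique w p : is_perm p -> same_order w p -> std w = p.
Proof.
move=> pp wp; have sp := same_order_trans (std_same_order w) wp.
apply: perm_same_order_eq => //; apply: std_perm.
apply/(uniqP 0) => i j; rewrite !inE => hi hj e; apply/eqP.
have [sz h] := wp; move: (h i j hi hj) (h j i hj hi); rewrite e ltnn => h1 h2.
have := @nth_uniq _ 0 p i j; rewrite -sz => /(_ hi hj (is_perm_uniq pp)) <-.
by rewrite eqn_leq leqNgt -h2 leqNgt -h1.
Qed.

Lemma nth_map0 s (ks : seq nat) i :
  i < size ks -> nth 0 [seq nth 0 s k | k <- ks] i = nth 0 s (nth 0 ks i).
Proof. by move=> h; rewrite (nth_map 0). Qed.

(** Occurrences given by positions can be located relative to minima and cells, which bare
    subsequences cannot. *)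
Lemma containsP s p : contains s p <-> exists ks, [/\ sorted ltn ks,
  all (fun k => k < size s) ks & same_order [seq nth 0 s k | k <- ks] p].
Proof.
split=> [[t /subseqP[m szm ->] so]|[ks [srt lt so]]].
  exists (mask m (iota 0 (size s))); split.
  - apply: (subseq_sorted ltn_trans (mask_subseq _ _)); exact: iota_ltn_sorted.
  - by apply/allP => k /mem_mask; rewrite mem_iota.
  - by rewrite map_mask -/(mkseq _ _) mkseq_nth.
exists [seq nth 0 s k | k <- ks] => //.
rewrite -{2}[s](mkseq_nth 0) /mkseq; apply: map_subseq.
rewrite (_ : ks = [seq k <- iota 0 (size s) | k \in ks]) ?filter_subseq //.
apply: (irr_sorted_eq ltn_trans ltnn) => //.
  apply: sorted_filter; [exact: ltn_trans | exact: iota_ltn_sorted].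
move=> k; rewrite mem_filter mem_iota /=.
by case: (boolP (k \in ks)) => // /(allP lt).
Qed.

Lemma contains_same_order s t p :
  same_order s t -> contains s p -> contains t p.
Proof.
move=> [e h] /containsP[ks [srt lt so]]; apply/containsP; exists ks.
rewrite -e; split=> //; apply: same_order_trans so.
split=> [|i j]; rewrite !size_map // => hi hj.
by rewrite !nth_map0 // h //; apply: (allP lt); rewrite mem_nth.
Qed.

Lemma same_order_take k s p :
  same_order s p -> same_order (take k s) (take k p).
Proof.
move=> [e h]; split=> [|i j]; first by rewrite !size_take e.
rewrite size_take => hi hj; rewrite !nth_take ?h //; case: ifP hi hj; lia.
Qed.

Lemma contains_take k s p : contains s p -> contains s (take k p).
Proof.
move=> [t ts so]; exists (take k t); last exact: same_order_take.
apply: subseq_trans ts; exact: take_subseq.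
Qed.

(** * Indecomposability through cuts *)

(** Skew-indecomposability tested at cuts: were a cut crossed by no ascending pair, its two sides
    would be the summands of a skew sum. [sum_conn] is the analogue with descending pairs. *)
Definition skew_conn (p : seq nat) := forall k, 0 < k < size p ->
  exists i j, [/\ i < k, k <= j < size p & nth 0 p i < nth 0 p j].

Definition sum_conn (p : seq nat) := forall k, 0 < k < size p ->
  exists i j, [/\ i < k, k <= j < size p & nth 0 p j < nth 0 p i].

Lemma perm_mem_count s x :
  is_perm s -> x \in s -> x = count (fun y => y <= x) s.
Proof.
by move=> ps xs; rewrite -[in LHS](nth_index 0 xs) (perm_nth_count ps)
  ?index_mem // nth_index.
Qed.

(** Counting shows that the low part fills an initial interval of values and the high part the rest.
    The low part [u] is the prefix for direct sums and the suffix for skew sums. *)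
Lemma perm_split_low_high (p u v : seq nat) : is_perm p -> perm_eq p (u ++ v) ->
  (forall x y, x \in u -> y \in v -> x < y) ->
  [/\ is_perm u, is_perm [seq y - size u | y <- v] &
      {in v, forall y, y - size u + size u = y}].
Proof.
move=> pp puv uv; have puv' : is_perm (u ++ v).
  by rewrite /is_perm -(perm_size puv); apply: perm_trans pp; rewrite perm_sym.
have := is_perm_uniq puv'; rewrite cat_uniq => /and3P[uu _ vv].
have hu x : x \in u -> x <= size u.
  move=> xu; rewrite (perm_mem_count puv' (x := x)) ?mem_cat ?xu //.
  rewrite count_cat (_ : count _ v = 0) ?addn0 ?count_size //.
  apply/eqP; rewrite -leqn0 leqNgt -has_count; apply/hasPn => y yv.
  by have := uv _ _ xu yv; lia.
have hv y : y \in v -> size u < y <= size u + size v.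
  move=> yv; have yuv : y \in u ++ v by rewrite mem_cat yv orbT.
  have := is_perm_le puv' yuv; rewrite size_cat => ->; rewrite andbT.
  rewrite (perm_mem_count puv' yuv) count_cat -addn1 leq_add //.
    rewrite -{1}(count_predT u); apply: eq_leq; apply: eq_in_count => x xu.
    by have := uv _ _ xu yv; rewrite /=; lia.
  by rewrite -has_count; apply/hasP; exists y.
split.
- apply: is_perm_char => // x xu; rewrite hu // andbT.
  by apply: (is_perm_gt0 puv'); rewrite mem_cat xu.
- apply: is_perm_char => [|_ /mapP[y /hv yv ->]]; last by rewrite size_map; lia.
  by rewrite map_inj_in_uniq // => x y /hv ? /hv ?; lia.
- by move=> y /hv; lia.
Qed.

Lemma mem_take_nth (p : seq nat) k x : x \in take k p ->
  exists2 i, i < k & x = nth 0 p i.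
Proof.
move=> /(nthP 0)[i]; rewrite size_take_min leq_min => /andP[ik _] <-.
by exists i => //; rewrite nth_take.
Qed.

Lemma mem_drop_nth (p : seq nat) k x : x \in drop k p ->
  exists2 j, k <= j < size p & x = nth 0 p j.
Proof.
move=> /(nthP 0)[j]; rewrite size_drop => jk <-.
exists (k + j); last by rewrite nth_drop.
by rewrite leq_addr -ltn_subRL.
Qed.

Lemma skew_indec_conn p : is_perm p -> skew_indecomposable p -> skew_conn p.
Proof.
move=> pp ip k hk; apply: contrapT => no.
have [|x y /mem_drop_nth[j hj ->] /mem_take_nth[i hi ->]|pb pa e] :=
  @perm_split_low_high p (drop k p) (take k p) pp.
- by rewrite -{1}(cat_take_drop k p) perm_catC.
- have jp : j < size p by lia.
  have ip' : i < size p by lia.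
  rewrite ltn_neqAle nth_uniq ?is_perm_uniq //.
  rewrite leqNgt; case: ltnP => [h|_]; last by lia.
  by case: no; exists i, j.
apply: (ip _ _ pa pb).
- by move/(congr1 size); rewrite size_map size_takel /=; lia.
- by move/(congr1 size); rewrite size_drop /=; lia.
- rewrite /oskew -map_comp -[LHS](cat_take_drop k p); congr (_ ++ _).
  by rewrite -[LHS]map_id; apply/esym/eq_in_map => x /e.
Qed.

Lemma sum_indec_conn p : is_perm p -> sum_indecomposable p -> sum_conn p.
Proof.
move=> pp ip k hk; apply: contrapT => no.
have [|x y /mem_take_nth[i hi ->] /mem_drop_nth[j hj ->]|pa pb e] :=
  @perm_split_low_high p (take k p) (drop k p) pp.
- by rewrite cat_take_drop.
- have jp : j < size p by lia.
  have ip' : i < size p by lia.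
  rewrite ltn_neqAle nth_uniq ?is_perm_uniq //.
  rewrite leqNgt; case: ltnP => [h|_]; last by lia.
  by case: no; exists i, j.
apply: (ip _ _ pa pb).
- by move/(congr1 size); rewrite size_takel /=; lia.
- by move/(congr1 size); rewrite size_map size_drop /=; lia.
- rewrite /osum -map_comp -[LHS](cat_take_drop k p); congr (_ ++ _).
  by rewrite -[LHS]map_id; apply/esym/eq_in_map => x /e.
Qed.

Variant bar_spec (p : seq nat) : seq nat -> Prop :=
| BarRcons a of p = rcons a (size a).+1 : bar_spec p a
| BarId : bar_spec p p.

Lemma barP p : bar_spec p (bar p).
Proof.
rewrite /bar; case: eqP => h; last by constructor.
by constructor; rewrite {1}h /osum /= add1n -cats1.
Qed.

Lemma bar_perm p : is_perm p -> is_perm (bar p).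
Proof.
case: barP => // a -> pp; apply: is_perm_char.
  by have := is_perm_uniq pp; rewrite rcons_uniq => /andP[].
move=> x xa; have xr : x \in rcons a (size a).+1 by rewrite mem_rcons inE xa orbT.
have := is_perm_le pp xr; rewrite (is_perm_gt0 pp xr) size_rcons /=.
have : x != (size a).+1; last by lia.
apply: contraTneq (is_perm_uniq pp) => <-.
by rewrite rcons_uniq xa.
Qed.

Lemma contains_bar s p : contains s p -> contains s (bar p).
Proof.
case: barP => // a ->; move/(@contains_take (size a)).
by rewrite -cats1 take_size_cat.
Qed.

(** * Labels *)

Implicit Types F : nat -> nat -> seq nat.

(* [(j, 0, 0)] stands for the [j]-th left-to-right minimum and [(j, r.+1, x)]
   for the [x]-th entry, from left to right, of the cell in row [r] and column
   [j]. [plt] compares horizontally, [vlt F] vertically. *)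
Definition label := (nat * nat * nat)%type.

Definition lmin (j : nat) : label := (j, 0, 0).

Definition plt (a b : label) : bool :=
  (a.1.1 < b.1.1) || (a.1.1 == b.1.1) &&
  ((a.1.2 < b.1.2) || (a.1.2 == b.1.2) && (a.2 < b.2)).

(** Row [i] begins just above the [i]-th minimum, so that minimum counts as the lowest element of
    row [i]; the value 0 of [lcol] puts it before all cells of the row. *)
Definition lrow (a : label) : nat := if a.1.2 is r.+1 then r else a.1.1.

Definition lcol (a : label) : nat := if a.1.2 is r.+1 then a.1.1.+1 else 0.

Definition lval (F : nat -> nat -> seq nat) (a : label) : nat :=
  if a.1.2 is r.+1 then nth 0 (F r a.1.1) a.2 else 0.

Definition vlt (F : nat -> nat -> seq nat) (a b : label) : bool :=
  (lrow b < lrow a) || (lrow a == lrow b) &&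
  ((lcol a < lcol b) || (lcol a == lcol b) && (lval F a < lval F b)).

Definition valid (F : nat -> nat -> seq nat) (n : nat) (a : label) : bool :=
  if a.1.2 is r.+1 then a.2 < size (F r a.1.1) else (a.1.1 < n) && (a.2 == 0).

Definition staircase (F : nat -> nat -> seq nat) (n : nat) :=
  forall i j, 0 < size (F i j) -> i <= j < n.

(** Independence in arithmetic form: for [i < i'] and [j < j'] the spanned rectangle lies in the
    staircase exactly when its lower left corner [(i', j)] does, that is when [i' <= j]. *)
Definition ud_free (F : nat -> nat -> seq nat) := forall i j i' j',
  0 < size (F i j) -> 0 < size (F i' j') -> j < j' ->
  i <= i' /\ (i < i' -> j < i').

Lemma plt_irr : irreflexive plt.
Proof. by move=> a; rewrite /plt; lia. Qed.

Lemma plt_trans : transitive plt.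
Proof. by move=> b a c; rewrite /plt; lia. Qed.

Lemma plt_asym a b : plt a b -> plt b a = false.
Proof. by rewrite /plt; lia. Qed.

Lemma plt_total a b : [|| a == b, plt a b | plt b a].
Proof.
by case: a b => [[j i] x] [[j' i'] x']; rewrite !xpair_eqE /plt /=; lia.
Qed.

Lemma vlt_irr F : irreflexive (vlt F).
Proof. by move=> a; rewrite /vlt; lia. Qed.

Lemma vlt_trans F : transitive (vlt F).
Proof. by move=> b a c; rewrite /vlt; lia. Qed.

Lemma vlt_asym F a b : vlt F a b -> ~~ vlt F b a.
Proof. by rewrite /vlt; lia. Qed.

Lemma vlt_cell F a b : 0 < a.1.2 -> 0 < b.1.2 -> vlt F a b =
  (b.1.2 < a.1.2) || (a.1.2 == b.1.2) &&
  ((a.1.1 < b.1.1) || (a.1.1 == b.1.1) && (lval F a < lval F b)).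
Proof.
by case: a b => [[j [|i]] x] [[j' [|i']] x'] //; rewrite /vlt /lrow /lcol /=; lia.
Qed.

Lemma vlt_total F n a b : (forall i j, uniq (F i j)) ->
  valid F n a -> valid F n b -> [|| a == b, vlt F a b | vlt F b a].
Proof.
move=> uF; case: a b => [[j [|i]] x] [[j' [|i']] x'];
  rewrite /valid /vlt /lrow /lcol /lval !xpair_eqE /=; try lia.
move=> vx vx'; case: (i =P i') => [ii|]; last by lia.
case: (j =P j') => [jj|]; last by lia.
move: vx'; rewrite -ii -jj => vx'.
have : (nth 0 (F i j) x == nth 0 (F i j) x') = (x == x') by exact: nth_uniq.
by lia.
Qed.

Lemma sw_min F n a : staircase F n -> valid F n a ->
  lrow a < n /\
  (a = lmin (lrow a) \/ plt (lmin (lrow a)) a /\ vlt F (lmin (lrow a)) a).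
Proof.
move=> st; case: a => [[j [|i]] x]; rewrite /valid /lrow /=.
  by case/andP=> jn /eqP->; split=> //; left.
move=> h; have := st i j; rewrite /plt /vlt /lrow /lcol /lval /lmin /=.
by split; [|right]; lia.
Qed.

Lemma ne_region F n c a : valid F n a -> plt (lmin c) a -> vlt F (lmin c) a ->
  exists r j x, [/\ a = (j, r.+1, x), x < size (F r j) & r <= c <= j].
Proof.
case: a => [[j [|r]] x];
  rewrite /valid /plt /vlt /lrow /lcol /lval /lmin /=; first by lia.
by move=> vx h h'; exists r, j, x; split=> //; lia.
Qed.

(** Row indices at most [c] and column indices at least [c] keep the spanned rectangle inside the
    staircase, so cells differing in both coordinates would be adjacent. *)
Lemma ud_free_collinear F c r j r' j' : ud_free F ->
  0 < size (F r j) -> 0 < size (F r' j') -> r <= c <= j -> r' <= c <= j' ->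
  r = r' \/ j = j'.
Proof.
move=> ud h h' b b'; have := ud _ _ _ _ h h'; have := ud _ _ _ _ h' h; lia.
Qed.

(** * Occurrences of patterns among labels *)

Local Notation l0 := (0, 0, 0).

Definition locc F n (ls : seq label) (p : seq nat) :=
  [/\ sorted plt ls, all (valid F n) ls, size ls = size p &
      forall i j, i < size p -> j < size p ->
        vlt F (nth l0 ls i) (nth l0 ls j) = (nth 0 p i < nth 0 p j)].

Lemma locc_take F n ls p k : locc F n ls p -> locc F n (take k ls) (take k p).
Proof.
move=> [srt val sz vo]; split.
- exact: subseq_sorted plt_trans _ _ (take_subseq _ _) srt.
- by apply/allP => a /mem_take; apply/allP.
- by rewrite !size_take sz.
- move=> i j; rewrite size_take => hi hj.
  rewrite !nth_take ?vo //; case: ifP hi hj; lia.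
Qed.

Lemma locc_cell F n ls p r j : locc F n ls p ->
  (forall a, a \in ls -> a.1 = (j, r.+1)) -> contains (F r j) p.
Proof.
move=> [srt val sz vo] hc; apply/containsP; exists [seq a.2 | a <- ls].
have E i : i < size ls -> nth l0 ls i = (j, r.+1, (nth l0 ls i).2).
  by move=> h; rewrite {1}[nth l0 ls i]surjective_pairing hc ?mem_nth.
split.
- apply/(sortedP 0) => i; rewrite size_map => hi.
  have := (sortedP l0 srt) i hi; rewrite !(nth_map l0) ?(ltnW hi) //.
  by rewrite E ?(ltnW hi) // (E i.+1) // /plt /=; lia.
- apply/allP => _ /mapP[a al ->]; have := allP val _ al.
  by rewrite /valid (hc _ al).
- split=> [|i k]; rewrite !size_map // => hi hk.
  rewrite !nth_map0 ?size_map // !(nth_map l0) //.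
  have := vo i k; rewrite -sz hi hk => <- //.
  by rewrite (E i) // (E k) // /vlt /lrow /lcol /lval /=; lia.
Qed.

Lemma locc_plt F n ls p i j : locc F n ls p -> i < j < size p ->
  plt (nth l0 ls i) (nth l0 ls j).
Proof.
move=> [srt _ sz _] /andP[ij jp].
by apply: (sorted_ltn_nth plt_trans l0 srt); rewrite ?inE ?sz //; lia.
Qed.

(* Cells met by an occurrence lying north-east of a minimum are pairwise
   collinear, hence all in one row or all in one column. *)
Lemma region_line F n c ls : ud_free F -> all (valid F n) ls ->
  (forall a, a \in ls -> plt (lmin c) a /\ vlt F (lmin c) a) ->
  (forall a b, a \in ls -> b \in ls -> a.1.2 = b.1.2) \/
  (forall a b, a \in ls -> b \in ls -> a.1.1 = b.1.1).
Proof.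
move=> ud val reg.
have col a b : a \in ls -> b \in ls -> a.1.2 = b.1.2 \/ a.1.1 = b.1.1.
  move=> al bl; have [pa va] := reg _ al; have [pb vb] := reg _ bl.
  have [r [j [x [-> hx hc]]]] := ne_region (allP val _ al) pa va.
  have [r' [j' [x' [-> hx' hc']]]] := ne_region (allP val _ bl) pb vb.
  by have := @ud_free_collinear F c r j r' j' ud; rewrite /=; lia.
case: (pselect (forall a b, a \in ls -> b \in ls -> a.1.2 = b.1.2)); first by left.
move=> nrow; right => a b al bl; apply: contrapT => nab; apply: nrow => u v ul vl.
have := col _ _ al bl; have := col _ _ al ul; have := col _ _ al vl.
have := col _ _ bl ul; have := col _ _ bl vl; have := col _ _ ul vl.
lia.
Qed.

(** Suppose the occurrence leaves the cell of its first label, first at index [k]. Along a row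
    everything before [k] lies below the rest, so only a final maximum removed by [bar] can be
    outside. Down a column everything before [k] lies above the rest, against skew-connectedness. *)
Lemma locc_region F n c ls p : staircase F n -> ud_free F ->
  locc F n ls p -> 0 < size p ->
  (forall a, a \in ls -> plt (lmin c) a /\ vlt F (lmin c) a) ->
  skew_conn p -> sum_conn (bar p) ->
  exists r j, 0 < size (F r j) /\ (contains (F r j) p \/
    contains (F r j) (bar p) /\ exists2 j', j < j' & 0 < size (F r j')).
Proof.
move=> st ud oc p0 reg skp sup; have [srt val sz vo] := oc.
have ne i : i < size p -> exists r j x,
    [/\ nth l0 ls i = (j, r.+1, x), x < size (F r j) & r <= c <= j].
  move=> hi; have al : nth l0 ls i \in ls by rewrite mem_nth ?sz.
  by have [pa va] := reg _ al; apply: ne_region pa va; apply: (allP val).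
have [r [j [x [E0 hx _]]]] := ne 0 p0; exists r, j; split; first by lia.
case: (pselect (forall a : label, a \in ls -> a.1 = (j, r.+1))) => [h|out].
  by left; apply: locc_cell oc h.
pose bad (a : label) := a.1 != (j, r.+1).
have hb : has bad ls.
  apply/negP => /negP; rewrite -all_predC => /allP h; apply: out => a /h.
  by rewrite /= negbK => /eqP.
pose k := find bad ls.
have kp : k < size p by rewrite -sz -has_find.
have badk : (nth l0 ls k).1 <> (j, r.+1) by apply/eqP/(nth_find _ hb).
have goodk i : i < k -> (nth l0 ls i).1 = (j, r.+1).
  by move=> hi; apply/eqP; have := before_find l0 hi; rewrite /bad => /negbFE.
have k0 : 0 < k by rewrite lt0n; apply/eqP => e; apply: badk; rewrite e E0.
have mm i : i < size p -> nth l0 ls i \in ls by move=> h; rewrite mem_nth ?sz.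
have pos i : i < size p -> 0 < (nth l0 ls i).1.2.
  by move=> /ne[ri [ji [xi [-> _ _]]]].
have le i l : i <= l < size p -> let a := nth l0 ls i in let b := nth l0 ls l in
    (a.1.1 < b.1.1) || (a.1.1 == b.1.1) && (a.1.2 <= b.1.2).
  case: (ltngtP i l) => //= [il hl|-> _]; last by lia.
  by have := @locc_plt F n ls p i l oc; rewrite il /plt; lia.
have [rowE|colE] := region_line ud val reg.
- right; have colk : j < (nth l0 ls k).1.1.
    have := rowE _ _ (mm 0 p0) (mm k kp); have := le 0 k; move: badk.
    rewrite E0 /=; case: (nth l0 ls k).1 => jk rk /= badk.
    have : jk <> j \/ rk <> r.+1.
      by case: (jk =P j) => [ej|]; [right => er; apply: badk; congr pair|left].
    by lia.
  have lo i l : i < k -> k <= l < size p -> nth 0 p i < nth 0 p l.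
    move=> ik hl; have lp : l < size p by lia.
    have ip : i < size p by lia.
    rewrite -vo // vlt_cell ?pos //; have := rowE _ _ (mm i ip) (mm l lp).
    by have := le _ _ hl; rewrite (goodk i ik) /=; lia.
  split; last first.
    exists (nth l0 ls k).1.1 => //; have [rk [jk [xk [E hk _]]]] := ne k kp.
    have := rowE _ _ (mm 0 p0) (mm k kp); rewrite E E0 /= => -[->].
    by apply: leq_ltn_trans hk.
  move: sup; case: barP => [a pE|] sup.
    (* [k <= size a] because [p] has just one entry more than [a]; a smaller [k] would be a cut of
       the sum-connected [a]. *)
    have ka : k = size a.
      apply/eqP; rewrite eqn_leq -ltnS -(size_rcons a (size a).+1) -pE kp /=.
      rewrite leqNgt; apply/negP => kla.
      have [|i [l [ik hl]]] := sup k; first by rewrite k0.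
      have := lo i l ik; rewrite pE size_rcons !nth_rcons.
      have -> : i < size a by lia.
      have -> : l < size a by lia.
      by lia.
    have -> : a = take k p by rewrite pE ka -cats1 take_size_cat.
    apply: (locc_cell (locc_take k oc)) => b /(nthP l0)[i].
    by rewrite size_take_min leq_min => /andP[ik _] <-; rewrite nth_take ?goodk.
  have [|i [l [ik hl]]] := sup k; first by rewrite k0.
  by have := lo i l ik hl; lia.
- have [|i [l [ik hl]]] := skp k; first by rewrite k0.
  have lp : l < size p by lia.
  have ip : i < size p by lia.
  have rk : r.+1 < (nth l0 ls k).1.2.
    have := colE _ _ (mm 0 p0) (mm k kp); have := le 0 k; move: badk.
    rewrite E0 /=; case: (nth l0 ls k).1 => jk rk /= badk.
    have : jk <> j \/ rk <> r.+1.
      by case: (jk =P j) => [ej|]; [right => er; apply: badk; congr pair|left].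
    by lia.
  rewrite -vo // vlt_cell ?pos //.
  have := colE _ _ (mm k kp) (mm l lp); have := le _ _ hl.
  by rewrite (goodk i ik) /=; lia.
Qed.

(** What the weights impose for one pattern: a cell that is not the rightmost non-empty one of its
    row must avoid the barred pattern as well. *)
Definition cell_free (F : nat -> nat -> seq nat) (p : seq nat) :=
  forall r j, 0 < size (F r j) -> ~ contains (F r j) p /\
    forall j', j < j' -> 0 < size (F r j') -> ~ contains (F r j) (bar p).

(** The label [c] playing the 1 may be exchanged for the minimum of its row, which is [c] itself or
    lies to its south-west; then [locc_region] applies. *)
Lemma no_one_sum F n c ls p : staircase F n -> ud_free F -> cell_free F p ->
  0 < size p -> skew_conn p -> sum_conn (bar p) ->
  valid F n c -> locc F n ls p ->
  (forall a, a \in ls -> plt c a /\ vlt F c a) -> False.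
Proof.
move=> st ud fr p0 skp sup vc oc sw; have [_ hm] := sw_min st vc.
have sw' a : a \in ls -> plt (lmin (lrow c)) a /\ vlt F (lmin (lrow c)) a.
  move=> /sw[pa va]; case: hm => [<- //|[pc vc']].
  by split; [apply: plt_trans pa | apply: vlt_trans va].
have [r [j [ne]]] := locc_region st ud oc p0 sw' skp sup.
have [no no'] := fr r j ne.
by case=> [/no|[h [j' jj' ne']]] //; apply: no' jj' ne' h.
Qed.

(** * Excluding 2413 and 3124 from the labels of a filling *)

Definition p2413 := [:: 2; 4; 1; 3].
Definition p3124 := [:: 3; 1; 2; 4].

Lemma skew_conn2413 : skew_conn p2413.
Proof.
by case=> [|[|[|[|k]]]] // _; [exists 0, 1|exists 0, 3|exists 0, 3].
Qed.

Lemma sum_conn2413 : sum_conn (bar p2413).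
Proof.
by case=> [|[|[|[|k]]]] // _; [exists 0, 2|exists 0, 2|exists 1, 3].
Qed.

Lemma skew_conn3124 : skew_conn p3124.
Proof.
by case=> [|[|[|[|k]]]] // _; [exists 0, 3|exists 0, 3|exists 0, 3].
Qed.

Lemma sum_conn3124 : sum_conn (bar p3124).
Proof. by case=> [|[|[|k]]] // _; [exists 0, 1|exists 0, 2]. Qed.

Lemma locc4 F n (a b c d : label) p : locc F n [:: a; b; c; d] p ->
  [/\ plt a b, plt b c, plt c d &
   [/\ valid F n a, valid F n b, valid F n c & valid F n d]].
Proof. by move=> [/= /and4P[-> -> -> _] /and5P[-> -> -> -> _]]. Qed.

Lemma no_2413 F n ls : staircase F n -> ud_free F -> cell_free F p2413 ->
  ~ locc F n ls p2413.
Proof.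
move=> st ud fr oc; have [_ _ sz vo] := oc.
case: ls sz oc vo => [|a [|b [|c [|d []]]]] // _ oc vo.
have [ab bc cd [va vb vc vd]] := locc4 oc.
have ca : vlt F c a by apply: (vo 2 0).
have ad : vlt F a d by apply: (vo 0 3).
have db : vlt F d b by apply: (vo 3 1).
have [_ ha] := sw_min st va; set i := lrow a in ha.
have [_ hc] := sw_min st vc; set k := lrow c in hc.
have ip x : plt a x -> plt (lmin i) x.
  by case: ha => [<- //|[h _]]; apply: plt_trans.
have iv x : vlt F a x -> vlt F (lmin i) x.
  by case: ha => [<- //|[_ h]]; apply: vlt_trans.
have kp x : plt c x -> plt (lmin k) x.
  by case: hc => [<- //|[h _]]; apply: plt_trans.
have kv x : vlt F c x -> vlt F (lmin k) x.
  by case: hc => [<- //|[_ h]]; apply: vlt_trans.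
have ac := plt_trans ab bc; have bd := plt_trans bc cd.
have ab' := vlt_trans ad db; have cd' := vlt_trans ca ad.
have [r [s [x [eb hx hr]]]] := ne_region vb (ip _ ab) (iv _ ab').
have [r' [s' [x' [ed hx' hr']]]] := ne_region vd (ip _ (plt_trans ac cd)) (iv _ ad).
(* A minimum [lmin i] below [c] differs from [a] and lies south-west of all four labels, so the
   region argument applies to 2413 itself. *)
have [ic|ic] := boolP (vlt F (lmin i) c).
  have [pa va'] : plt (lmin i) a /\ vlt F (lmin i) a.
    by case: ha => // e; move: ic; rewrite -e (negbTE (vlt_asym ca)).
  apply: (no_one_sum (c := lmin i) st ud fr _ skew_conn2413 sum_conn2413 _ oc) => //.
    by have [h _] := sw_min st va; rewrite /valid /= h.
  move=> y; rewrite !inE => /or4P[] /eqP-> //; split=> //; try exact: ip.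
  - exact: iv.
  - exact: ip (plt_trans ac cd).
  - exact: iv.
(* If [b] is to the left of [lmin k], its column precedes that of [d], and [d] being below [b] is in
   a lower row. Both cells are north-east of [lmin i], so their rectangle lies in the staircase. *)
have [pb|pb] := boolP (plt b (lmin k)).
  have ks' : k <= s' by move: (kp d cd); rewrite ed /plt /=; clear; lia.
  have sk : s < k by move: pb; rewrite eb /plt /=; clear; lia.
  have rr' : r < r'.
    by move: db; rewrite eb ed vlt_cell //=; move: sk ks'; clear; lia.
  have [|||_ /(_ rr')] := ud r s r' s'; move: hx hx' hr hr' sk ks'; clear; lia.
(* Now [b], [c], [d] are all north-east of [lmin k]. The row index of [c] exceeds [i] and that of
   [d] does not, so [c] and [d] share a column, in which the lower [c] cannot precede [d]. *)
have pkb : plt (lmin k) b by move: pb; rewrite eb /plt /=; clear; lia.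
have [pkc vkc] : plt (lmin k) c /\ vlt F (lmin k) c.
  by case: hc => // e; move: pb; rewrite -e bc.
have [r'' [s'' [x'' [ec hx'' hr'']]]] := ne_region vc pkc vkc.
have := ne_region vd (kp _ cd) (kv _ cd').
rewrite ed => -[r1 [s1 [x1 [[e1 e2 e3] _ hd]]]].
have := ne_region vb pkb (kv _ (vlt_trans cd' db)).
rewrite eb => -[r2 [s2 [x2 [[e4 e5 e6] _ hb]]]].
have := @ud_free_collinear F k r'' s'' r s ud.
have := @ud_free_collinear F k r'' s'' r' s' ud.
have ir'' : i < r''.
  by move: ic; rewrite ec /vlt /lmin /lrow /lcol /=; clear; lia.
have : (s'' < s') || (s'' == s') && (r'' <= r').
  by move: cd; rewrite ec ed /plt /=; clear; lia.
move: hx hx' hx'' hr hr' hr'' hd hb e1 e2 e4 e5 ir''; clear; lia.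
Qed.

Lemma no_3124 F n ls : staircase F n -> ud_free F -> cell_free F p3124 ->
  ~ locc F n ls p3124.
Proof.
move=> st ud fr oc; have [_ _ sz vo] := oc.
case: ls sz oc vo => [|a [|b [|c [|d []]]]] // _ oc vo.
have [ab bc cd [va vb vc vd]] := locc4 oc.
have bc' : vlt F b c by apply: (vo 1 2).
have ca : vlt F c a by apply: (vo 2 0).
have ad : vlt F a d by apply: (vo 0 3).
have [_ hb] := sw_min st vb; set i := lrow b in hb.
have [_ ha] := sw_min st va; set k := lrow a in ha.
have ip x : plt b x -> plt (lmin i) x.
  by case: hb => [<- //|[h _]]; apply: plt_trans.
have iv x : vlt F b x -> vlt F (lmin i) x.
  by case: hb => [<- //|[_ h]]; apply: vlt_trans.
have kp x : plt a x -> plt (lmin k) x.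
  by case: ha => [<- //|[h _]]; apply: plt_trans.
have kv x : vlt F a x -> vlt F (lmin k) x.
  by case: ha => [<- //|[_ h]]; apply: vlt_trans.
have ac := plt_trans ab bc; have bd := plt_trans bc cd.
have ba := vlt_trans bc' ca; have cd' := vlt_trans ca ad.
have bd' := vlt_trans ba ad.
(* A minimum [lmin i] to the left of [a] lies south-west of all four labels, so the region argument
   applies to 3124 itself. *)
have [ia|ia] := boolP (plt (lmin i) a).
  have [pb vb'] : plt (lmin i) b /\ vlt F (lmin i) b.
    by case: hb => // e; move: ia; rewrite -e (plt_asym ab).
  apply: (no_one_sum (c := lmin i) st ud fr _ skew_conn3124 sum_conn3124 _ oc) => //.
    by have [h _] := sw_min st vb; rewrite /valid /= h.
  move=> y; rewrite !inE => /or4P[] /eqP-> //; split=> //;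
    by [apply: iv | apply: ip].
have ai : plt a (lmin i).
  case/or3P: (plt_total a (lmin i)) => // [/eqP e|h]; last by rewrite h in ia.
  by have := iv _ ba; rewrite e vlt_irr.
have [r [s [x [ec hx hr]]]] := ne_region vc (ip _ bc) (iv _ bc').
have [r' [s' [x' [ed hx' hr']]]] := ne_region vd (ip _ bd) (iv _ bd').
(* If [lmin k] is below [c], both [a] and [c] are north-east of it. The column index of [a] is less
   than [i] and that of [c] is not, so they share a row, where [c] would be above [a]. *)
have [kc|kc] := boolP (vlt F (lmin k) c).
  have [pa va'] : plt (lmin k) a /\ vlt F (lmin k) a.
    by case: ha => // e; move: kc; rewrite -e (negbTE (vlt_asym ca)).
  have [r2 [s2 [x2 [ea hx2 hr2]]]] := ne_region va pa va'.
  have := ne_region vc (kp _ ac) kc; rewrite ec => -[r1 [s1 [x1 [[e1 e2 e3] _ hc]]]].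
  have := @ud_free_collinear F k r2 s2 r s ud.
  have s2i : s2 < i by move: ai; rewrite ea /plt /=; clear; lia.
  have : (r2 < r) || (r2 == r) && ((s < s2) || (s == s2)).
    by move: ca; rewrite ea ec vlt_cell //=; clear; lia.
  by move: hx hx2 hr hr2 hc e1 e2 s2i; clear; lia.
(* The row index of [c] exceeds [k] and that of [d] does not; both cells are north-east of [lmin i],
   hence in one column, where [d] would come before [c]. *)
have kr : k < r by move: kc; rewrite ec /vlt /lmin /lrow /lcol /=; clear; lia.
have r'k : r' <= k.
  by move: (kv _ ad); rewrite ed /vlt /lmin /lrow /lcol /=; clear; lia.
have : (s < s') || (s == s') && (r <= r').
  by move: cd; rewrite ec ed /plt /=; clear; lia.
have := @ud_free_collinear F i r s r' s' ud.
move: hx hx' hr hr' kr r'k; clear; lia.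
Qed.

(** * The permutation of a filling *)

Definition cell_pos s i j := [seq k <- iota 0 (size s) | in_cell s i j k].

(** The encoding on arbitrary index pairs, free of the dependent type of cells. *)
Definition se_fun s i j := std [seq nth 0 s k | k <- cell_pos s i j].

Definition label_enum F n (L : seq label) :=
  sorted plt L /\ forall a, (a \in L) = valid F n a.

Lemma label_enum_ex F n : staircase F n -> exists L, label_enum F n L.
Proof.
move=> st.
pose cs := [seq (j, r.+1) | j <- iota 0 n, r <- iota 0 n].
pose L0 : seq label := [seq (j, 0, 0) | j <- iota 0 n] ++
  [seq (c, x) | c <- cs, x <- iota 0 (size (F c.2.-1 c.1))].
have mem a : (a \in undup L0) = valid F n a.
  rewrite mem_undup mem_cat; case: a => [[j i] x]; apply/orP/idP.
    case=> [/mapP[j' hj' [-> -> ->]]|/allpairsPdep[c [y [hc hy [-> ->]]]]].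
      by move: hj'; rewrite mem_iota /valid /=; lia.
    move: hc hy => /allpairsP[[j' r] /= [_ _ ->]]; rewrite mem_iota /valid /=; lia.
  case: i => [|r]; rewrite /valid /=.
    case/andP=> jn /eqP->; left; apply/mapP; exists j => //.
    by rewrite mem_iota; lia.
  move=> hx; right; apply/allpairsPdep; exists (j, r.+1), x; split=> //.
    have := st r j => h; apply/allpairsP; exists (j, r) => /=.
    by rewrite !mem_iota; split=> //; lia.
  by rewrite mem_iota /=; lia.
(* Sorting uses a total relation, the reflexive closure of [plt]; the absence of duplicates makes
   the result strictly sorted. *)
pose ple a b := ~~ plt b a.
have srt : sorted ple (sort ple (undup L0)).
  by apply: sort_sorted => a b; rewrite /ple /plt; lia.
exists (sort ple (undup L0)); split=> [|a]; last by rewrite mem_sort.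
apply/(sortedP l0) => i hi; have := (sortedP l0 srt) i hi.
have := plt_total (nth l0 (sort ple (undup L0)) i) (nth l0 (sort ple (undup L0)) i.+1).
rewrite nth_uniq ?sort_uniq ?undup_uniq ?(ltnW hi) // /ple.
by rewrite -[_ == _.+1]/(_ == _) (ltn_eqF (ltnSn i)) /= => /orP[//|->].
Qed.

Lemma label_enum_uniq F n L : label_enum F n L -> uniq L.
Proof. by case=> srt _; apply: (sorted_uniq plt_trans plt_irr). Qed.

Lemma plt_nth F n L k l : label_enum F n L -> k < size L -> l < size L ->
  plt (nth l0 L k) (nth l0 L l) = (k < l).
Proof.
move=> [srt _] hk hl; have hm := sorted_ltn_nth plt_trans l0 srt.
have [kl|lk|->] := ltngtP k l; last by rewrite plt_irr.
  by rewrite hm.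
by rewrite plt_asym // hm.
Qed.

(** Labels read from left to right with their heights recorded: the candidate preimage of the
    filling. *)
Definition perm_of F (L : seq label) := [seq rank (vlt F) L a | a <- L].

Lemma valid_total F n L : (forall i j, uniq (F i j)) -> label_enum F n L ->
  {in L &, forall a b, [|| a == b, vlt F a b | vlt F b a]}.
Proof. by move=> uF [_ E] a b; rewrite !E; apply: vlt_total. Qed.

Lemma perm_of_perm F n L : (forall i j, uniq (F i j)) -> label_enum F n L ->
  is_perm (perm_of F L).
Proof.
move=> uF en; apply: rank_perm.
- exact: vlt_irr.
- exact: vlt_trans.
- exact: label_enum_uniq en.
- exact: valid_total en.
Qed.

Lemma perm_of_lt F n L k l : (forall i j, uniq (F i j)) -> label_enum F n L ->
  k < size L -> l < size L ->
  (nth 0 (perm_of F L) k < nth 0 (perm_of F L) l) =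
  vlt F (nth l0 L k) (nth l0 L l).
Proof.
move=> uF en hk hl; rewrite !(nth_map l0) //.
apply: rank_ltE; rewrite ?mem_nth //; last exact: valid_total en.
- exact: vlt_irr.
- exact: vlt_trans.
Qed.

Lemma perm_of_locc F n L p : (forall i j, uniq (F i j)) -> label_enum F n L ->
  contains (perm_of F L) p -> exists ls, locc F n ls p.
Proof.
move=> uF en /containsP[ks]; rewrite size_map => -[srt lt [sz so]].
have hk i : i < size ks -> nth 0 ks i < size L.
  by move=> h; apply: (allP lt); rewrite mem_nth.
rewrite size_map in sz; exists [seq nth l0 L k | k <- ks]; split.
- apply/(sortedP l0) => i; rewrite size_map => hi.
  rewrite !(nth_map 0) ?(ltnW hi) // (plt_nth en) ?hk ?(ltnW hi) //.
  exact: (sortedP 0 srt).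
- apply/allP => _ /mapP[k kk ->]; case: en => _ <-; rewrite mem_nth //.
  exact: (allP lt).
- by rewrite size_map.
- move=> i j; rewrite -sz => hi hj; have := so i j; rewrite size_map => <- //.
  by rewrite !nth_map0 // (perm_of_lt uF en) ?hk // !(nth_map 0).
Qed.

Lemma perm_of_avoids_one_sum F n L p : (forall i j, uniq (F i j)) ->
  staircase F n -> ud_free F -> label_enum F n L -> is_perm p -> p <> [::] ->
  cell_free F p -> skew_conn p -> sum_conn (bar p) ->
  ~ contains (perm_of F L) (osum [:: 1] p).
Proof.
move=> uF st ud en pp p0 fr skp sup /(perm_of_locc uF en)[[|c ls] oc].
  by have [] := oc.
have [/= srt /andP[vc vls] [sz] vo] := oc; rewrite size_map in sz.
have oc' : locc F n ls p.
  split=> //; first exact: path_sorted srt.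
  move=> i j hi hj; have := vo i.+1 j.+1; rewrite size_map /= => -> //.
  by rewrite !(nth_map 0) //; lia.
apply: (no_one_sum st ud fr _ skp sup vc oc'); first by case: (p) p0.
move=> a al; split; first by have /(order_path_min plt_trans)/allP := srt; apply.
have hi : index a ls < size p by rewrite -sz index_mem.
have := vo 0 (index a ls).+1; rewrite /= size_map (nth_map 0) // nth_index //.
by move=> -> //; rewrite addn1 ltnS; apply: is_perm_gt0 (mem_nth _ _).
Qed.

Lemma all_take_nth (T : Type) (x0 : T) (a : pred T) s k : k <= size s ->
  all a (take k s) <-> forall l, l < k -> a (nth x0 s l).
Proof.
move=> ks; split=> [/(all_nthP x0) h l lk|h].
  by have := h l; rewrite size_takel // nth_take // => ->.
apply/(all_nthP x0) => l; rewrite size_takel // => lk; rewrite nth_take //; exact: h.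
Qed.

(** An entry of column [j] has the [j]-th minimum to its left and below it. Conversely, a cell to
    the left of a minimum has row index at most its column index, hence lies above that minimum. *)
Lemma perm_of_lrmin F n L k : (forall i j, uniq (F i j)) -> staircase F n ->
  label_enum F n L -> k < size L ->
  is_lrmin (perm_of F L) k = ((nth l0 L k).1.2 == 0).
Proof.
move=> uF st en hk; have [_ E] := en.
have vk : valid F n (nth l0 L k) by rewrite -E mem_nth.
apply/idP/idP; rewrite /is_lrmin.
  move/(all_take_nth 0); rewrite size_map => /(_ (ltnW hk)) h.
  case e : (nth l0 L k) => [[j [|r]] x] //=.
  have hj := st r j; move: vk; rewrite e /valid /= => vx.
  have mL : lmin j \in L by rewrite E /valid /=; lia.
  have hi : index (lmin j) L < size L by rewrite index_mem.
  have lt : index (lmin j) L < k.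
    by rewrite -(plt_nth en) // nth_index // e /plt /=; lia.
  have := h _ lt; rewrite (perm_of_lt uF en) // nth_index // e.
  by rewrite /vlt /lrow /lcol /=; lia.
move=> e0; apply/(all_take_nth 0); first by rewrite size_map ltnW.
move=> l lk; have hl := ltn_trans lk hk.
have := lk; rewrite -(plt_nth en) // (perm_of_lt uF en) //.
have vl : valid F n (nth l0 L l) by rewrite -E mem_nth.
move: e0 vk vl; case: (nth l0 L k) => [[j i] x] /= /eqP->.
case: (nth l0 L l) => [[j' [|r']] x']; rewrite /valid /plt /vlt /lrow /lcol /=.
  by lia.
by have := st r' j'; lia.
Qed.

Lemma perm_of_lrmin_pos F n L : (forall i j, uniq (F i j)) -> staircase F n ->
  label_enum F n L ->
  lrmin_pos (perm_of F L) = [seq index (lmin j) L | j <- iota 0 n].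
Proof.
move=> uF st en; have [_ E] := en.
have mL j : j < n -> lmin j \in L by move=> h; rewrite E /valid /= h.
apply: (irr_sorted_eq ltn_trans ltnn).
- apply: sorted_filter; [exact: ltn_trans | exact: iota_ltn_sorted].
- apply/(sortedP 0) => i; rewrite size_map size_iota => hi.
  rewrite !(nth_map 0) ?size_iota ?(ltnW hi) // !nth_iota ?(ltnW hi) //.
  rewrite -(plt_nth en) ?index_mem ?mL ?(ltnW hi) //.
  by rewrite !nth_index ?mL ?(ltnW hi) // /plt /=; lia.
move=> k; rewrite mem_filter mem_iota size_map /= add0n andbC.
apply/andP/mapP => [[hk]|[j]].
  rewrite (perm_of_lrmin uF st en) // => e.
  have : valid F n (nth l0 L k) by rewrite -E mem_nth.
  case e' : (nth l0 L k) e => [[j i] x] /= /eqP i0; rewrite /valid i0 /=.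
  move=> /andP[jn /eqP x0]; exists j; first by rewrite mem_iota.
  have <- : nth l0 L k = lmin j by rewrite e' i0 x0.
  by rewrite index_uniq // (label_enum_uniq en).
rewrite mem_iota /= add0n => jn ->; rewrite index_mem mL //; split=> //.
by rewrite (perm_of_lrmin uF st en) ?index_mem ?mL // nth_index ?mL.
Qed.

Lemma perm_of_in_cell F n L i j k : (forall i j, uniq (F i j)) ->
  staircase F n -> label_enum F n L -> k < size L ->
  in_cell (perm_of F L) i j k = ((nth l0 L k).1 == (j, i.+1)).
Proof.
move=> uF st en hk; have [_ E] := en.
have mL h : h < n -> lmin h \in L by move=> hn; rewrite E /valid /= hn.
rewrite /in_cell /lrmin_val (perm_of_lrmin_pos uF st en) !size_map size_iota.
rewrite (perm_of_lrmin uF st en) //.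
have P h : h < n -> (nth 0 [seq index (lmin j) L | j <- iota 0 n] h < k) =
    plt (lmin h) (nth l0 L k).
  move=> hn; rewrite (nth_map 0) ?size_iota // nth_iota // add0n.
  by rewrite -(plt_nth en) ?index_mem ?mL // nth_index ?mL.
have V h : h < n -> (nth 0 [seq nth 0 (perm_of F L) k |
    k <- [seq index (lmin j) L | j <- iota 0 n]] h < nth 0 (perm_of F L) k) =
    vlt F (lmin h) (nth l0 L k).
  move=> hn; rewrite nth_map0 ?size_map ?size_iota //.
  rewrite (nth_map 0) ?size_iota // nth_iota // add0n.
  by rewrite (perm_of_lt uF en) ?index_mem ?mL // nth_index ?mL.
have : valid F n (nth l0 L k) by rewrite -E mem_nth.
case e : (nth l0 L k) => [[jk [|r]] x]; rewrite /valid /= ?xpair_eqE ?andbF //.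
move=> hx; have hr := st r jk.
apply/andP/andP => [[/and3P[jn hj /allP aj] /and3P[i_n hi /allP ai]]|[/eqP<- /eqP[<-]]].
  move: hj hi; rewrite P // V // e => hj hi.
  have := aj jk; have := ai r; rewrite !mem_iota P; last by lia.
  rewrite V; last by lia.
  by move: hj hi; rewrite e /plt /vlt /lrow /lcol /=; lia.
split; apply/and3P; split; try by lia.
- by rewrite P ?e /plt /=; lia.
- apply/allP => h; rewrite mem_iota => hn; rewrite P ?e /plt /=; lia.
- by rewrite V ?e /vlt /lrow /lcol /=; lia.
- apply/allP => h; rewrite mem_iota => hn; rewrite V ?e /vlt /lrow /lcol /=; lia.
Qed.

(** Within one cell [plt] follows the positions and [vlt] the values of [F i j], so the entries
    found there are order isomorphic to the permutation [F i j], and standardizing gives it back. *)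
Lemma perm_of_se F n L i j : (forall i j, is_perm (F i j)) ->
  staircase F n -> label_enum F n L -> se_fun (perm_of F L) i j = F i j.
Proof.
move=> pF st en; have [_ E] := en.
have uF i' j' : uniq (F i' j') by apply: is_perm_uniq.
pose lb x : label := (j, i.+1, x).
have mL x : x < size (F i j) -> lb x \in L by rewrite E.
have -> : se_fun (perm_of F L) i j = std [seq nth 0 (perm_of F L) k |
    k <- [seq index (lb x) L | x <- iota 0 (size (F i j))]].
  congr (std (map _ _)); apply: (irr_sorted_eq ltn_trans ltnn).
  - apply: sorted_filter; [exact: ltn_trans | exact: iota_ltn_sorted].
  - apply/(sortedP 0) => x; rewrite size_map size_iota => hx.
    rewrite !(nth_map 0) ?size_iota ?(ltnW hx) // !nth_iota ?(ltnW hx) //.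
    rewrite -(plt_nth en) ?index_mem ?mL ?(ltnW hx) //.
    by rewrite !nth_index ?mL ?(ltnW hx) // /plt /=; lia.
  move=> k; rewrite mem_filter mem_iota size_map /= add0n andbC.
  apply/andP/mapP => [[hk]|[x]].
    rewrite (perm_of_in_cell _ _ uF st en) // => /eqP e.
    have : valid F n (nth l0 L k) by rewrite -E mem_nth.
    rewrite /valid e /= => hx; exists (nth l0 L k).2; first by rewrite mem_iota.
    by rewrite /lb -e -surjective_pairing index_uniq // (label_enum_uniq en).
  rewrite mem_iota /= add0n => hx ->; rewrite index_mem mL //; split=> //.
  by rewrite (perm_of_in_cell _ _ uF st en) ?index_mem ?mL // nth_index ?mL.
apply: std_unique => //; split; rewrite !size_map size_iota // => x y hx hy.
rewrite !nth_map0 ?size_map ?size_iota // !(nth_map 0) ?size_iota //.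
rewrite !nth_iota // !add0n (perm_of_lt uF en) ?index_mem ?mL //.
by rewrite !nth_index ?mL // /vlt /lrow /lcol /lval /=; lia.
Qed.

(** * Geometry of the staircase *)

Local Notation lp s := (nth 0 (lrmin_pos s)).
Local Notation lv s j := (nth 0 s (nth 0 (lrmin_pos s) j)).
Local Notation nmin s := (size (lrmin_pos s)).

Lemma mem_lrmin_pos s k : (k \in lrmin_pos s) = (k < size s) && is_lrmin s k.
Proof. by rewrite mem_filter mem_iota andbC. Qed.

Lemma lp_in s j : j < nmin s -> (lp s j < size s) /\ is_lrmin s (lp s j).
Proof.
move=> h; have : lp s j \in lrmin_pos s by rewrite mem_nth.
by rewrite mem_lrmin_pos => /andP[].
Qed.

Lemma lp_lt s i j : i < nmin s -> j < nmin s -> (lp s i < lp s j) = (i < j).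
Proof.
move=> hi hj; have srt : sorted ltn (lrmin_pos s).
  apply: sorted_filter; [exact: ltn_trans | exact: iota_ltn_sorted].
have hm := sorted_ltn_nth ltn_trans 0 srt.
have [ij|ji|->] := ltngtP i j; last by rewrite ltnn.
- exact: hm.
- by apply/negbTE; rewrite -leqNgt ltnW // hm.
Qed.

Lemma lrminP s k : k < size s ->
  is_lrmin s k <-> forall l, l < k -> nth 0 s k < nth 0 s l.
Proof. by move=> h; apply: (all_take_nth 0); apply: ltnW. Qed.

Lemma lv_lt s i j : i < j -> j < nmin s -> lv s j < lv s i.
Proof.
move=> ij hj; have [hs /lrminP] := lp_in hj; apply=> //.
by rewrite lp_lt // (ltn_trans ij).
Qed.

(** An entry that is not a minimum has an earlier entry not above it; descent to that entry ends at
    a minimum. *)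
Lemma lrmin_below s k : k < size s ->
  exists2 j, j < nmin s & lp s j <= k /\ lv s j <= nth 0 s k.
Proof.
elim/ltn_ind: k => k IH hk; have [hm|nm] := boolP (is_lrmin s k).
  have km : k \in lrmin_pos s by rewrite mem_lrmin_pos hk.
  by exists (index k (lrmin_pos s)); rewrite ?index_mem // nth_index.
have [l [lk sl]] : exists l, l < k /\ nth 0 s l <= nth 0 s k.
  apply: contrapT => no; move/negP: nm; apply; apply/lrminP => // l lk.
  by rewrite ltnNge; apply/negP => h; apply: no; exists l.
have [j hj [h1 h2]] := IH l lk (ltn_trans lk hk).
by exists j => //; split; [apply: leq_trans h1 (ltnW lk)|apply: leq_trans sl].
Qed.

(** Comparison with every minimum replaces the extremal definition of the cell; both strict
    directions are kept because a non-minimum entry never ties with a minimum. *)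
Record cell_at s i j k : Prop := CellAt {
  ca_size : k < size s;
  ca_le : i <= j < nmin s;
  ca_pos : forall h, h < nmin s -> (lp s h < k) = (h <= j);
  ca_pos' : forall h, h < nmin s -> (k < lp s h) = (j < h);
  ca_val : forall h, h < nmin s -> (lv s h < nth 0 s k) = (i <= h);
  ca_val' : forall h, h < nmin s -> (nth 0 s k < lv s h) = (h < i) }.

Lemma nonmin_neq s k h : uniq s -> k < size s -> ~~ is_lrmin s k ->
  h < nmin s -> lp s h != k /\ lv s h != nth 0 s k.
Proof.
move=> us hk nm hh; have [h1 h2] := lp_in hh.
have e : lp s h != k by apply: contraTneq h2 => ->.
by rewrite nth_uniq.
Qed.

Lemma cell_posP s i j k : uniq s -> k \in cell_pos s i j -> cell_at s i j k.
Proof.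
move=> us; rewrite mem_filter mem_iota /= add0n => /andP[+ hk].
rewrite /in_cell size_map => /and3P[nm /and3P[jn hj /allP aj] /and3P[i_n hi /allP ai]].
have nq h : h < nmin s -> lp s h != k /\ lv s h != nth 0 s k.
  exact: nonmin_neq.
have vE h : h < nmin s -> nth 0 (lrmin_val s) h = lv s h.
  by move=> hh; rewrite (nth_map 0).
rewrite vE // in hi.
have P h : h < nmin s -> (lp s h < k) = (h <= j).
  move=> hh; apply/idP/idP => [h1|]; first by have := aj h; rewrite mem_iota hh h1; apply.
  by rewrite leq_eqVlt -(lp_lt hh jn) => /orP[/eqP-> //|h1]; apply: ltn_trans h1 hj.
have V h : h < nmin s -> (lv s h < nth 0 s k) = (i <= h).
  move=> hh; apply/idP/idP => [h1|].
    by have := ai h; rewrite mem_iota vE // hh h1; apply.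
  by rewrite leq_eqVlt => /orP[/eqP<- //|h1]; apply: ltn_trans (lv_lt h1 hh) hi.
split=> //.
- rewrite jn andbT; have [h hh [h1 h2]] := lrmin_below hk.
  have [n1 n2] := nq h hh; apply: (@leq_trans h).
    by rewrite -V // ltn_neqAle n2.
  by rewrite -P // ltn_neqAle n1.
- by move=> h hh; rewrite [RHS]ltnNge -P // -leqNgt [RHS]leq_eqVlt eq_sym
    (negbTE (proj1 (nq h hh))).
- by move=> h hh; rewrite [RHS]ltnNge -V // -leqNgt [RHS]leq_eqVlt eq_sym
    (negbTE (proj2 (nq h hh))).
Qed.

Lemma cell_pos_ex s k : uniq s -> k < size s -> ~~ is_lrmin s k ->
  exists i j, k \in cell_pos s i j.
Proof.
move=> us hk nm; have [h hh [h1 h2]] := lrmin_below hk.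
have [n1 n2] := nonmin_neq us hk nm hh.
have [j /andP[jn hj] jmax] : {j | (j < nmin s) && (lp s j < k) &
    forall h, (h < nmin s) && (lp s h < k) -> h <= j}.
  case: (@ex_maxnP (fun h => (h < nmin s) && (lp s h < k)) (nmin s)).
  - by exists h; rewrite hh ltn_neqAle n1.
  - by move=> ? /andP[/ltnW].
  - by move=> j h3 h4; exists j.
have [i /andP[i_n hi] imin] : {i | (i < nmin s) && (lv s i < nth 0 s k) &
    forall h, (h < nmin s) && (lv s h < nth 0 s k) -> i <= h}.
  case: (@ex_minnP (fun h => (h < nmin s) && (lv s h < nth 0 s k))).
  - by exists h; rewrite hh ltn_neqAle n2.
  - by move=> i h3 h4; exists i.
exists i, j; rewrite mem_filter mem_iota /= hk andbT /in_cell nm /= size_map.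
apply/andP; split; apply/and3P; split=> //.
- apply/allP => h'; rewrite mem_iota /= => hn; apply/implyP => lt.
  by apply: jmax; rewrite hn.
- by rewrite (nth_map 0).
- apply/allP => h'; rewrite mem_iota /= => hn; rewrite (nth_map 0) //.
  by apply/implyP => lt; apply: imin; rewrite hn.
Qed.

Lemma contains2413 s a b c d : a < b < c -> c < d < size s ->
  nth 0 s c < nth 0 s a < nth 0 s d -> nth 0 s d < nth 0 s b ->
  contains s p2413.
Proof.
move=> ab cd h h'; apply/containsP; exists [:: a; b; c; d]; split.
- by rewrite /=; lia.
- by rewrite /=; lia.
- by split=> // -[|[|[|[|i]]]] [|[|[|[|j]]]] //= _ _; lia.
Qed.

Lemma contains3124 s a b c d : a < b < c -> c < d < size s ->
  nth 0 s b < nth 0 s c < nth 0 s a -> nth 0 s a < nth 0 s d ->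
  contains s p3124.
Proof.
move=> ab cd h h'; apply/containsP; exists [:: a; b; c; d]; split.
- by rewrite /=; lia.
- by rewrite /=; lia.
- by split=> // -[|[|[|[|i]]]] [|[|[|[|j]]]] //= _ _; lia.
Qed.

Lemma cells_col_lt s i j k i' j' l :
  cell_at s i j k -> cell_at s i' j' l -> j < j' -> k < l.
Proof.
move=> [_ _ _ pk' _ _] [_ hl pl _ _ _] jj'; have jn : j' < nmin s by lia.
by apply: (@ltn_trans (lp s j')); rewrite ?pk' ?pl.
Qed.

Lemma cells_row_lt s i j k i' j' l :
  cell_at s i j k -> cell_at s i' j' l -> i < i' -> nth 0 s l < nth 0 s k.
Proof.
move=> [_ hk _ _ vk _] [_ _ _ _ _ vl'] ii'; have i_n : i < nmin s by lia.
by apply: (@ltn_trans (lv s i)); rewrite ?vk ?vl'.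
Qed.

Lemma same_row_increasing s i j k j' l : uniq s -> ~ contains s p2413 ->
  cell_at s i j k -> cell_at s i j' l -> j < j' -> nth 0 s k < nth 0 s l.
Proof.
move=> us av ck cl jj'; have kl := cells_col_lt ck cl jj'.
case: ck cl => hk lk pk pk' vk vk' [hl ll pl pl' vl vl'].
rewrite ltn_neqAle nth_uniq // (ltn_eqF kl) leqNgt /=; apply/negP => lt.
have [i_n jn] : i < nmin s /\ j' < nmin s by lia.
apply: av; apply: (@contains2413 _ (lp s i) k (lp s j') l).
- by rewrite pk ?pk' //; lia.
- by rewrite pl // leqnn.
- by rewrite lv_lt ?vl //; lia.
- exact: lt.
Qed.

Lemma same_col_decreasing s i j k i' l : uniq s -> ~ contains s p3124 ->
  cell_at s i j k -> cell_at s i' j l -> i < i' -> k < l.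
Proof.
move=> us av ck cl ii'; have vkl := cells_row_lt ck cl ii'.
case: ck cl => hk lk pk pk' vk vk' [hl ll pl pl' vl vl'].
rewrite ltnNge; apply/negP; rewrite leq_eqVlt => /orP[/eqP e|lt].
  by move: vkl; rewrite e ltnn.
have [i_n i_n'] : i < nmin s /\ i' < nmin s by lia.
apply: av; apply: (@contains3124 _ (lp s i) (lp s i') l k).
- by rewrite lp_lt // pl //; lia.
- by rewrite lt.
- by rewrite vl // vl' //; lia.
- by rewrite vk.
Qed.

(** If [i' < i], the minima [i'] and [i] followed by the two entries form 3124. If [i < i'] and
    [i' <= j], the minimum [i'], the left entry, the minimum [j'] and the right entry form 2413. *)
Lemma cells_ud s i j k i' j' l : uniq s -> ~ contains s p2413 ->
  ~ contains s p3124 -> cell_at s i j k -> cell_at s i' j' l -> j < j' ->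
  i <= i' /\ (i < i' -> j < i').
Proof.
move=> us av av' ck cl jj'; have kl := cells_col_lt ck cl jj'.
case: ck (ck) cl (cl) => hk lk pk pk' vk vk' ck [hl ll pl pl' vl vl'] cl.
split=> [|ii']; rewrite leqNgt; apply/negP => h.
- apply: av'; apply: (@contains3124 _ (lp s i') (lp s i) k l).
  + by rewrite lp_lt ?pk //; lia.
  + by rewrite kl.
  + by rewrite vk ?vk' //; lia.
  + by rewrite vl //; lia.
- have vkl := cells_row_lt ck cl ii'.
  apply: av; apply: (@contains2413 _ (lp s i') k (lp s j') l).
  + by rewrite pk ?pk' //; lia.
  + by rewrite pl //; lia.
  + by rewrite lv_lt ?vl //; lia.
  + exact: vkl.
Qed.

Lemma se_fun_nonempty s i j : 0 < size (se_fun s i j) ->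
  exists k, k \in cell_pos s i j.
Proof.
rewrite size_std size_map => h; exists (nth 0 (cell_pos s i j) 0).
by rewrite mem_nth.
Qed.

Lemma se_fun_perm s i j : uniq s -> is_perm (se_fun s i j).
Proof.
move=> us; apply: std_perm; rewrite map_inj_in_uniq ?filter_uniq ?iota_uniq //.
move=> k l; rewrite !mem_filter !mem_iota /= => /andP[_ hk] /andP[_ hl] /eqP.
by rewrite nth_uniq // => /eqP.
Qed.

Lemma se_fun_staircase s : uniq s -> staircase (se_fun s) (nmin s).
Proof. by move=> us i j /se_fun_nonempty[k /(cell_posP us)[]]. Qed.

Lemma se_fun_ud s : uniq s -> ~ contains s p2413 -> ~ contains s p3124 ->
  ud_free (se_fun s).
Proof.
move=> us av av' i j i' j' /se_fun_nonempty[k /(cell_posP us) ck].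
by move=> /se_fun_nonempty[l /(cell_posP us) cl]; apply: cells_ud us av av' ck cl.
Qed.

(** * Lifting patterns from a cell to the whole permutation *)

Lemma se_fun_contains s i j p : contains (se_fun s i j) p ->
  exists ks, [/\ sorted ltn ks, forall k, k \in ks -> k \in cell_pos s i j &
    same_order [seq nth 0 s k | k <- ks] p].
Proof.
move/(contains_same_order (std_same_order _)) => [t /subseqP[m szm ->] so].
exists (mask m (cell_pos s i j)); split; last by rewrite map_mask.
  apply: (subseq_sorted ltn_trans (mask_subseq _ _)).
  apply: sorted_filter; [exact: ltn_trans | exact: iota_ltn_sorted].
by move=> k /mem_mask.
Qed.

Lemma se_fun_contains_perm s i j p : uniq s ->
  contains (se_fun s i j) p -> contains s p.
Proof.
move=> us /se_fun_contains[ks [srt hk so]]; apply/containsP; exists ks; split=> //.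
by apply/allP => k /hk /(cell_posP us)[].
Qed.

Lemma same_order_one_sum t p v : is_perm p -> same_order t p ->
  (forall x, x \in t -> v < x) -> same_order (v :: t) (osum [:: 1] p).
Proof.
move=> pp [sz so] hv; split; first by rewrite /= size_map sz.
have gt0 i : i < size t -> 0 < nth 0 p i.
  by rewrite sz => h; apply: (is_perm_gt0 pp); rewrite mem_nth.
have E i : i < size t -> nth 0 [seq x + 1 | x <- p] i = (nth 0 p i).+1.
  by rewrite sz => h; rewrite (nth_map 0) // addn1.
move=> [|i] [|j] //=; rewrite ?ltnS => hi hj; rewrite ?ltnn ?E //.
- by rewrite ltnS gt0 // hv // mem_nth.
- by apply/negbTE; rewrite -leqNgt ltnW // hv // mem_nth.
- by rewrite ltnS so.
Qed.

Lemma same_order_rcons t q w : is_perm q -> same_order t q ->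
  (forall x, x \in t -> x < w) ->
  same_order (rcons t w) (rcons q (size q).+1).
Proof.
move=> pq [sz so] hw; split; first by rewrite !size_rcons sz.
have le i : i < size t -> nth 0 q i <= size q.
  by rewrite sz => h; apply: (is_perm_le pq); rewrite mem_nth.
have lt i : i < size t -> nth 0 t i < w by move=> h; rewrite hw ?mem_nth.
move=> i j; rewrite size_rcons !ltnS !nth_rcons -sz => hi hj.
case: (ltngtP i (size t)) hi => // [hi _|_ _];
  case: (ltngtP j (size t)) hj => // [hj _|_ _].
- exact: so.
- by rewrite lt // sz ltnS le.
- by rewrite ltnNge ltnW ?lt //= sz [RHS]ltnNge ltnW // ltnS le.
- by rewrite !ltnn.
Qed.

(** The minimum of row [i] precedes and lies below the whole cell, so it can serve as the 1. *)
Lemma se_fun_contains_one_sum s i j p : uniq s -> is_perm p ->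
  contains (se_fun s i j) p -> i < nmin s -> contains s (osum [:: 1] p).
Proof.
move=> us pp /se_fun_contains[ks [srt hk so]] i_n; apply/containsP.
have ck k : k \in ks -> cell_at s i j k by move=> /hk /(cell_posP us).
exists (lp s i :: ks); split.
- rewrite /= path_min_sorted //; apply/allP => k /ck [? ? P ? ? ?] /=.
  by rewrite P //; lia.
- by rewrite /= (proj1 (lp_in i_n)); apply/allP => k /ck[].
- apply: same_order_one_sum => // _ /mapP[k /ck[? ? ? ? V ?] ->].
  by rewrite V.
Qed.

(* A non-empty cell further right in the same row contributes a new maximum,
   and the minimum of the row a new minimum. *)
Lemma se_fun_contains_rcons s i j j' q : uniq s -> ~ contains s p2413 ->
  is_perm q -> contains (se_fun s i j) q -> j < j' -> 0 < size (se_fun s i j') ->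
  contains s (rcons q (size q).+1) /\
  (is_perm (rcons q (size q).+1) -> contains s (osum [:: 1] (rcons q (size q).+1))).
Proof.
move=> us av pq /se_fun_contains[ks [srt hk so]] jj' /se_fun_nonempty[l].
move=> /(cell_posP us) cl.
have ck k : k \in ks -> cell_at s i j k by move=> /hk /(cell_posP us).
have i_n : i < nmin s by case: cl; lia.
have kl k : k \in ks -> k < l by move=> /ck h; apply: cells_col_lt h cl jj'.
have srt' : sorted ltn (rcons ks l).
  move: srt; rewrite !(sorted_pairwise ltn_trans) pairwise_rcons => ->.
  by rewrite andbT; apply/allP.
have so' : same_order [seq nth 0 s k | k <- rcons ks l] (rcons q (size q).+1).
  rewrite map_rcons; apply: same_order_rcons => // _ /mapP[k /ck h ->].
  exact: same_row_increasing h cl jj'.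
have lt : all (fun k => k < size s) (rcons ks l).
  by rewrite all_rcons (ca_size cl); apply/allP => k /ck[].
split; first by apply/containsP; exists (rcons ks l).
move=> pp; apply/containsP; exists (lp s i :: rcons ks l); split.
- rewrite /= path_min_sorted //; apply/allP => k.
  rewrite mem_rcons inE => /orP[/eqP->|/ck[? ? P ? ? ?]] /=.
    by case: cl => ? ? P *; rewrite P //; lia.
  by rewrite P //; lia.
- by rewrite /= (proj1 (lp_in i_n)).
- apply: same_order_one_sum => // _ /mapP[k + ->].
  rewrite mem_rcons inE => /orP[/eqP->|/ck[? ? ? ? V ?]]; last by rewrite V.
  by case: cl => ? ? ? ? V ?; rewrite V.
Qed.

(** * Reconstruction from the encoding *)

Definition label_pos s (a : label) :=
  if a.1.2 is r.+1 then nth 0 (cell_pos s r a.1.1) a.2 else lp s a.1.1.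

Lemma label_pos_cell s r j x : uniq s ->
  valid (se_fun s) (nmin s) (j, r.+1, x) ->
  x < size (cell_pos s r j) /\ cell_at s r j (nth 0 (cell_pos s r j) x).
Proof.
move=> us; rewrite /valid /= size_std size_map => hx; split=> //.
by apply: cell_posP => //; rewrite mem_nth.
Qed.

Lemma label_pos_lt s a b : uniq s -> ~ contains s p3124 ->
  valid (se_fun s) (nmin s) a -> valid (se_fun s) (nmin s) b ->
  plt a b -> label_pos s a < label_pos s b.
Proof.
move=> us av; case: a b => [[j [|r]] x] [[j' [|r']] x'] va vb;
  rewrite /plt /label_pos /=.
- move: va vb => /andP[/= jn /eqP->] /andP[/= jn' /eqP->].
  by rewrite lp_lt //; lia.
- have [hx' [_ _ P _ _ _]] := label_pos_cell us vb.
  by move: va => /andP[/= jn _]; rewrite P //; lia.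
- have [hx [_ _ _ P _ _]] := label_pos_cell us va.
  move: vb => /andP[/= jn _]; rewrite P //; lia.
- have [hx cx] := label_pos_cell us va; have [hx' cx'] := label_pos_cell us vb.
  case: ltngtP => [jj' _|//|e] /=; first exact: cells_col_lt cx cx' jj'.
  move: hx' cx'; rewrite -e ltnS eqSS => hx' cx'.
  case: ltngtP => [rr' _|//|e'] /=; first exact: same_col_decreasing cx cx' rr'.
  move: hx'; rewrite -e' => hx' xx'.
  apply: (sorted_ltn_nth ltn_trans) => //.
  apply: sorted_filter; [exact: ltn_trans | exact: iota_ltn_sorted].
Qed.

Lemma label_pos_vlt s a b : uniq s -> ~ contains s p2413 ->
  valid (se_fun s) (nmin s) a -> valid (se_fun s) (nmin s) b ->
  vlt (se_fun s) a b -> nth 0 s (label_pos s a) < nth 0 s (label_pos s b).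
Proof.
move=> us av; case: a b => [[j [|r]] x] [[j' [|r']] x'] va vb;
  rewrite /vlt /lrow /lcol /lval /label_pos /=.
- move: va vb => /andP[/= jn _] /andP[/= jn' _].
  by rewrite ?ltnn andbF !orbF => jj'; apply: lv_lt.
- have [hx' [_ _ _ _ V _]] := label_pos_cell us vb.
  by move: va => /andP[/= jn _]; rewrite V //; lia.
- have [hx [_ _ _ _ _ V]] := label_pos_cell us va.
  move: vb => /andP[/= jn _]; rewrite V //; lia.
- have [hx cx] := label_pos_cell us va; have [hx' cx'] := label_pos_cell us vb.
  case: ltngtP => [rr' _|//|e] /=; first exact: cells_row_lt cx' cx rr'.
  move: hx' cx'; rewrite e ltnS eqSS => hx' cx'.
  case: ltngtP => [jj' _|//|e'] /=; first exact: same_row_increasing cx cx' jj'.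
  move: hx'; rewrite -e' => hx'.
  have [_ so] := std_same_order [seq nth 0 s k | k <- cell_pos s r j].
  by rewrite /se_fun so ?size_std ?size_map // !nth_map0.
Qed.

(** [label_pos] maps the labels in [plt] order increasingly onto all positions and carries [vlt] to
    the order of values, so [s] and the rebuilt permutation are order isomorphic, hence equal. *)
Lemma perm_of_se_fun s L : is_perm s -> ~ contains s p2413 ->
  ~ contains s p3124 -> label_enum (se_fun s) (nmin s) L ->
  s = perm_of (se_fun s) L.
Proof.
move=> ps av av' en; have us := is_perm_uniq ps; have [srt E] := en.
have uF i j : uniq (se_fun s i j) by apply/is_perm_uniq/se_fun_perm.
have posE : [seq label_pos s a | a <- L] = iota 0 (size s).
  apply: (irr_sorted_eq ltn_trans ltnn).
  - apply/(sortedP 0) => k; rewrite size_map => hk.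
    rewrite !(nth_map l0) ?(ltnW hk) //; apply: label_pos_lt => //.
    + by rewrite -E mem_nth // ltnW.
    + by rewrite -E mem_nth.
    + exact: (sortedP l0 srt).
  - exact: iota_ltn_sorted.
  move=> k; rewrite mem_iota /= add0n; apply/mapP/idP => [[a + ->]|hk].
    rewrite E; case: a => [[j [|r]] x] va.
      by move: va => /andP[/= jn _]; have [] := lp_in jn.
    by have [_ []] := label_pos_cell us va.
  have [hm|nm] := boolP (is_lrmin s k).
    have km : k \in lrmin_pos s by rewrite mem_lrmin_pos hk.
    exists (lmin (index k (lrmin_pos s))); last by rewrite /label_pos /= nth_index.
    by rewrite E /valid /= index_mem km.
  have [i [j kc]] := cell_pos_ex us hk nm.
  exists (j, i.+1, index k (cell_pos s i j)); last by rewrite /label_pos /= nth_index.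
  by rewrite E /valid /= size_std size_map index_mem.
have szE : size L = size s by rewrite -(size_map (label_pos s)) posE size_iota.
have kE k : k < size s -> label_pos s (nth l0 L k) = k.
  move=> hk; rewrite -(nth_map l0 0 (label_pos s)) ?szE // posE nth_iota //.
have vk k : k < size s -> valid (se_fun s) (nmin s) (nth l0 L k).
  by move=> hk; rewrite -E mem_nth ?szE.
apply: perm_same_order_eq => //; first exact: perm_of_perm en.
split=> [|k l hk hl]; first by rewrite size_map szE.
rewrite (perm_of_lt uF en) ?szE //.
have H a b := @label_pos_vlt s (nth l0 L a) (nth l0 L b) us av.
(* [label_pos_vlt] is only one implication; totality of [vlt] supplies the converse. *)
have [kl|lk|e] := ltngtP (nth 0 s k) (nth 0 s l).
- case/or3P: (vlt_total uF (vk k hk) (vk l hl)) => // [/eqP e|lk].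
    by move: kl; rewrite -{1}(kE k hk) -{1}(kE l hl) e ltnn.
  by have := H l k (vk l hl) (vk k hk) lk; rewrite !kE // ltnNge ltnW.
- apply/esym/negbTE/negP => kl.
  by have := H k l (vk k hk) (vk l hl) kl; rewrite !kE // ltnNge ltnW.
- have -> : k = l by apply/eqP; rewrite -(nth_uniq 0 hk hl us) e.
  by rewrite vlt_irr.
Qed.

(** * Fillings as functions on the grid *)

(** The default off the staircase is the empty word, in keeping with [staircase]. *)
Definition fun_of n (f : filling n) (i j : nat) : seq nat :=
  if [pick c : cell n | (row c == i) && (col c == j)] is Some c then f c else [::].

Lemma cell_eq n (c d : cell n) : row c = row d -> col c = col d -> c = d.
Proof.
move=> r q; apply: val_inj; move: r q; rewrite /row /col.
by case: (val c) (val d) => [? ?] [? ?] /= /val_inj-> /val_inj->.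
Qed.

Lemma cell_bound n (c : cell n) : row c <= col c < n.
Proof. by rewrite (valP c) /col ltn_ord. Qed.

Lemma cell_ex n i j : i <= j < n -> exists c : cell n, row c = i /\ col c = j.
Proof.
move=> /andP[ij jn].
by exists (exist _ (Ordinal (leq_ltn_trans ij jn), Ordinal jn) ij).
Qed.

Lemma fun_of_cell n (f : filling n) (c : cell n) : fun_of f (row c) (col c) = f c.
Proof.
rewrite /fun_of; case: pickP => [d /andP[/eqP r /eqP q]|/(_ c)].
  by rewrite (cell_eq r q).
by rewrite !eqxx.
Qed.

Lemma fun_of_ex n (f : filling n) i j : 0 < size (fun_of f i j) ->
  exists2 c : cell n, c \in Defs.support f & row c = i /\ col c = j.
Proof.
rewrite /fun_of; case: pickP => // c /andP[/eqP r /eqP q] h; exists c => //.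
by rewrite inE -size_eq0 -lt0n.
Qed.

Lemma support_size n (f : filling n) (c : cell n) :
  c \in Defs.support f -> 0 < size (fun_of f (row c) (col c)).
Proof. by rewrite inE fun_of_cell lt0n size_eq0. Qed.

Lemma fun_of_SE s i j : uniq s -> fun_of (SE (nmin s) s) i j = se_fun s i j.
Proof.
move=> us; rewrite /fun_of; case: pickP => [c /andP[/eqP<- /eqP<-]|no].
  by rewrite ffunE.
case e : (se_fun s i j) => [//|x t]; have := @se_fun_staircase s us i j.
rewrite e => /(_ isT)/cell_ex[c [r q]].
by have := no c; rewrite r q !eqxx.
Qed.

Lemma UD_halfE n (c d : cell n) : UD_half c d = (col c < col d) &&
  ((row d < row c) || (row c < row d) && (row d <= col c)).
Proof.
rewrite /UD_half; have [qq|] := ltnP (col c) (col d); last by rewrite !andbF.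
rewrite andbT /=; congr orb; have [rr|//] := ltnP (row c) (row d).
apply/forallP/idP => [h|le r].
  (* The lower left corner is the point of the rectangle that leaves the staircase first. *)
  have := forallP (h (val d).1) (val c).2.
  by rewrite -/(row d) -/(col c) (ltnW rr) !leqnn (ltnW qq).
by apply/forallP => q; apply/implyP; lia.
Qed.

Lemma independent_ud_free n (f : filling n) :
  independent (@UD n) (Defs.support f) <-> ud_free (fun_of f).
Proof.
split=> [ind i j i' j' /fun_of_ex[c cs [<- <-]] /fun_of_ex[d ds [<- <-]] qq|ud c d].
  have cd : c != d by apply: contraTneq qq => ->; rewrite ltnn.
  by have := ind c d cs ds cd; rewrite /UD !UD_halfE; lia.
move=> /support_size cs /support_size ds _; rewrite /UD !UD_halfE.
by have := ud _ _ _ _ cs ds; have := ud _ _ _ _ ds cs; lia.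
Qed.

Lemma rho_weight_y n (f : filling n) (c : cell n) j' : col c < j' ->
  0 < size (fun_of f (row c) j') -> rho c (Defs.support f) = weight_y.
Proof.
move=> lt /fun_of_ex[d ds [r q]]; rewrite /rho; case: existsP => // -[].
by exists d; rewrite ds r q eqxx.
Qed.

(** * Image, injectivity and surjectivity of the encoding *)

Local Open Scope classical_set_scope.

Lemma SE_in_WI (P : set (seq nat)) n s
  (P_perm : forall p, P p -> is_perm p /\ p <> [::]) :
  Avn n ([set p2413; p3124] `|` (osum [:: 1] @` P)) s ->
  WI (@rho n) (@UD n) (Avplus ([set [:: 3; 1; 2]] `|` (bar @` P)))
     (Avplus ([set p2413; p3124] `|` P)) (SE n s).
Proof.
case=> -[ps av] <-; have us := is_perm_uniq ps.
have av1 : ~ contains s p2413 by apply: av; left; left.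
have av2 : ~ contains s p3124 by apply: av; left; right.
have av3 p : P p -> ~ contains s (osum [:: 1] p).
  by move=> Pp; apply: av; right; exists p.
have E : fun_of (SE (nmin s) s) = se_fun s.
  by apply/funext => i; apply/funext => j; apply: fun_of_SE.
split; first by apply/independent_ud_free; rewrite E; apply: se_fun_ud.
move=> v vs; have := support_size vs; rewrite -(fun_of_cell _ v) E => sz.
have ne : se_fun s (row v) (col v) <> [::] by move=> e; rewrite e in sz.
have rn : row v < nmin s by have := cell_bound v; lia.
have pv : is_perm (se_fun s (row v) (col v)) by apply: se_fun_perm.
rewrite /rho; case: existsP => [[u /and3P[us' /eqP r lt]]|_]; split=> //; split=> // p.
  have := support_size us'; rewrite E r => szu.
  have Q q pq c := @se_fun_contains_rcons s _ _ _ q us av1 pq c lt szu.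
  (* The entry in [u] acts as a new maximum: it turns 312 into 3124, and it restores the maximum if
     [bar] removed one from [p0]. The row minimum then supplies the 1 of the forbidden sum. *)
  case=> [->|[p0 Pp <-]] c; first by have [] := Q _ _ c.
  have [pp0 _] := P_perm _ Pp; move: c (bar_perm pp0).
  case: barP => [a e c pa|c _].
    have [_] := Q _ pa c; rewrite -e => /(_ pp0); exact: av3.
  exact: av3 Pp (se_fun_contains_one_sum us pp0 c rn).
case=> [[]->|Pp] c.
- exact: av1 (se_fun_contains_perm us c).
- exact: av2 (se_fun_contains_perm us c).
- have [pp _] := P_perm _ Pp; exact: av3 Pp (se_fun_contains_one_sum us pp c rn).
Qed.

(** The encoding fixes the labels and both orders on them, from which [perm_of_se_fun] rebuilds
    either permutation. *)
Lemma SE_inj n s t : is_perm s -> ~ contains s p2413 -> ~ contains s p3124 ->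
  is_perm t -> ~ contains t p2413 -> ~ contains t p3124 ->
  nmin s = n -> nmin t = n -> SE n s = SE n t -> s = t.
Proof.
move=> ps s1 s2 pt t1 t2 ns nt e.
have us := is_perm_uniq ps; have ut := is_perm_uniq pt.
have F : se_fun s = se_fun t.
  apply/funext => i; apply/funext => j.
  by rewrite -fun_of_SE // -(fun_of_SE _ _ ut) ns nt e.
have [L en] := label_enum_ex (se_fun_staircase us).
rewrite (perm_of_se_fun ps s1 s2 en) F; apply/esym; apply: perm_of_se_fun => //.
by rewrite -F nt -ns.
Qed.

Lemma SE_surj (P : set (seq nat)) n (f : filling n)
  (P_perm : forall p, P p -> is_perm p /\ p <> [::])
  (P_skew : forall p, P p -> skew_indecomposable p)
  (P_bar : forall p, (bar @` P) p -> sum_indecomposable p) :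
  WI (@rho n) (@UD n) (Avplus ([set [:: 3; 1; 2]] `|` (bar @` P)))
     (Avplus ([set p2413; p3124] `|` P)) f ->
  exists2 s, Avn n ([set p2413; p3124] `|` (osum [:: 1] @` P)) s & SE n s = f.
Proof.
case=> /independent_ud_free ud cls; set F := fun_of f in ud.
have pF i j : is_perm (F i j).
  case e : (F i j) => [//|x t]; rewrite -e.
  have [|c cs [<- <-]] := @fun_of_ex n f i j; first by rewrite -/F e.
  by rewrite /F fun_of_cell; have := cls c cs; case: rho => -[[]].
have uF i j := is_perm_uniq (pF i j).
have st : staircase F n.
  by move=> i j /fun_of_ex[c _ [<- <-]]; apply: cell_bound.
(* A cell may have either weight, so both classes must exclude [p]; a non-empty cell further right
   forces weight [y], whose class must also exclude [bar p]. *)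
have free p : (forall w, Avplus ([set [:: 3; 1; 2]] `|` (bar @` P)) w ->
      ~ contains w p /\ ~ contains w (bar p)) ->
    (forall w, Avplus ([set p2413; p3124] `|` P) w -> ~ contains w p) ->
    cell_free F p.
  move=> hy hz i j sz; have [c cs [r q]] := fun_of_ex sz; rewrite -r -q.
  have wc := cls c cs; split=> [|j' lt sz'].
    by rewrite /F fun_of_cell; move: wc; case: rho => [/hy[]|/hz].
  rewrite /F fun_of_cell; move: wc; rewrite (rho_weight_y lt sz').
  by move=> /hy[].
have f1 : cell_free F p2413.
  apply: free => w [[pw av] _]; last by apply: av; left; left.
  (* The last three entries of 2413 form a 312, and [bar] fixes 2413. *)
  have no : ~ contains w p2413.
    move=> [t ts [sz so]]; apply: (av [:: 3; 1; 2]); first by left.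
    exists (behead t).
      by apply: subseq_trans ts; case: (t) => //= x t'; apply: subseq_cons.
    case: t sz so {ts} => [|a [|b [|c [|d []]]]] // _ so; split=> // i j hi hj.
    have := so i.+1 j.+1 hi hj => /= ->.
    by case: i j hi hj => [|[|[|i]]] [|[|[|j]]].
  by split.
have f2 : cell_free F p3124.
  apply: free => w [[pw av] _]; last by apply: av; left; right.
  (* 312 is exactly [bar p3124]. *)
  have no : ~ contains w [:: 3; 1; 2] by apply: av; left.
  by split=> // /contains_bar.
have f3 p : P p -> cell_free F p.
  move=> Pp; apply: free => w [[pw av] _]; last by apply: av; right.
  have no : ~ contains w (bar p) by apply: av; right; exists p.
  by split=> // /contains_bar.
have [L en] := label_enum_ex st.
exists (perm_of F L); last first.
  apply/ffunP => c; rewrite ffunE -(fun_of_cell f c) -/F.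
  exact: (perm_of_se _ _ pF st en).
split; last by rewrite (perm_of_lrmin_pos uF st en) size_map size_iota.
split; first exact: perm_of_perm en.
move=> _ [[]->|[p Pp <-]].
- by move=> /(perm_of_locc uF en)[ls]; apply: no_2413.
- by move=> /(perm_of_locc uF en)[ls]; apply: no_3124.
have [pp p0] := P_perm _ Pp.
apply: (perm_of_avoids_one_sum uF st ud en) => //.
- exact: f3.
- exact: skew_indec_conn (P_skew _ Pp).
- by apply: sum_indec_conn (P_bar _ _); [apply: bar_perm | exists p].
Qed.

Theorem theorem8p1 (P : set (seq nat)) (n : nat)
  (P_perm : forall p, P p -> is_perm p /\ p <> [::])
  (P_skew : forall p, P p -> skew_indecomposable p)
  (P_bar : forall p, (bar @` P) p -> sum_indecomposable p) :
  set_bij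
    (Avn n ([set [:: 2; 4; 1; 3]; [:: 3; 1; 2; 4]] `|` (osum [:: 1] @` P)))
    (WI (@rho n) (@UD n)
       (Avplus ([set [:: 3; 1; 2]] `|` (bar @` P)))
       (Avplus ([set [:: 2; 4; 1; 3]; [:: 3; 1; 2; 4]] `|` P)))
    (@SE n).
Proof.
split.
- by move=> s; apply: SE_in_WI.
- move=> s t /set_mem[[ps avs] ns] /set_mem[[pt avt] nt]; apply: SE_inj => //.
  + by apply: avs; left; left.
  + by apply: avs; left; right.
  + by apply: avt; left; left.
  + by apply: avt; left; right.
- by move=> f /(SE_surj P_perm P_skew P_bar)[s hs <-]; exists s.
Qed.
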